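(* Let $a_2(x):=\frac{(1-x)^4}{(e^x-ex)^2}$ for $x\in[0,1)$ and $a_2(1):=4/e^2$. On every $1$-regular input $(G,\bm{x})$ such that $G$ has no cycles of length $3$ or $5$, Algorithm 2 (Attenuate-ROM) with attenuation function $a_2$ selects every edge $f$ with probability at least $\gamma x_f$, where \[ \gamma=\frac{e^6+e^4-42-4e^2}{2e^6}\ge 0.478983. \]
   Context: Here $e$ denotes Euler's number. For a finite graph $G=(V,E)$, $\partial(v)$ is the set of edges incident to $v$. A fractional matching is $\bm{x}\in[0,1]^E$ with $\sum_{f\in\partial(v)}x_f\le1$ for all $v$; $(G,\bm{x})$ is $1$-regular if equality holds at every vertex. Each edge $f$ is active independently with probability $x_f$. The edges arrive in a uniformly random order. Algorithm 2 (Attenuate-ROM) with attenuation function $a:[0,1]\to[0,1]$: start with $\mathcal{M}=\emptyset$; when edge $f$ arrives, draw an independent $A_f\sim\mathrm{Ber}(a(x_f))$, and add $f$ to $\mathcal{M}$ if $f$ is active, $A_f=1$, and neither endpoint of $f$ is covered by an edge already in $\mathcal{M}$; output $\mathcal{M}$.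
   Formalization: The inequality γ ≥ 0.478983 is false as printed, since γ = 0.47898256…; the formal statement proves instead that |γ − 0.478983| ≤ 0.5·10⁻⁶. The selection guarantee with the exact γ is unchanged. *)

(* Defs.v *)
(* MathComp / MathComp-Analysis *)
From mathcomp Require Import all_boot all_order all_fingroup all_algebra.
From mathcomp Require Import reals sequences bernoulli_distribution.
Set Implicit Arguments.
Unset Strict Implicit.
Unset Printing Implicit Defensive.
Import Order.TTheory GRing.Theory Num.Theory.
Local Open Scope ring_scope.

Record sgraph := SGraph {
  vertex :> finType;
  edges : {set {set vertex}};
  edges_card2 : {in edges, forall f : {set vertex}, #|f| = 2%N}
}.

Definition edge (G : sgraph) : finType := {f : {set G} | f \in edges G}.

Definition ends (G : sgraph) (f : edge G) : {set G} := sval f.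

Definition adj (G : sgraph) : rel G := fun u v => [set u; v] \in edges G.

(* A k-cycle is a cyclic sequence of k pairwise distinct vertices;
   this is only meaningful for k >= 3. *)
Definition has_cycle_of_length (G : sgraph) (k : nat) : Prop :=
  exists2 c : seq G, size c = k & ucycle (@adj G) c.

Definition incident (G : sgraph) (v : G) : {set edge G} :=
  [set f | v \in ends f].

Section FractionalMatching.
Variables (R : realType) (G : sgraph) (x : edge G -> R).

Definition fractional_matching : Prop :=
  (forall f, 0 <= x f <= 1) /\
  (forall v : G, \sum_(f in incident v) x f <= 1).

Definition one_regular : Prop :=
  fractional_matching /\ (forall v : G, \sum_(f in incident v) x f = 1).

End FractionalMatching.

Section AttenuateROM.
Variables (R : realType) (G : sgraph) (x : edge G -> R) (a : R -> R).

(* All the randomness is drawn up front: an outcome is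
   ((arrival order, activity bits), attenuation bits A_f). *)
Definition outcome : finType :=
  ({perm edge G} * {ffun edge G -> bool} * {ffun edge G -> bool})%type.

Definition active (w : outcome) (f : edge G) : bool := w.1.2 f.
Definition attenuation_bit (w : outcome) (f : edge G) : bool := w.2 f.

(* A uniform permutation applied to a fixed enumeration of the edges gives a
   uniformly random arrival order. *)
Definition arrivals (w : outcome) : seq (edge G) :=
  [seq w.1.1 f | f <- enum (edge G)].

Definition outcome_pmf (w : outcome) : R :=
  #|{perm edge G}|%:R^-1
  * (\prod_f bernoulli_pmf (x f) (active w f))
  * (\prod_f bernoulli_pmf (a (x f)) (attenuation_bit w f)).

Definition Pr (event : pred outcome) : R :=
  \sum_(w | event w) outcome_pmf w.

Definition covered (M : {set edge G}) (v : G) : bool :=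
  [exists g in M, v \in ends g].

Definition rom_step (w : outcome) (M : {set edge G}) (f : edge G) :
    {set edge G} :=
  if [&& active w f, attenuation_bit w f
       & [forall v in ends f, ~~ covered M v]]
  then f |: M else M.

Definition attenuate_rom (w : outcome) : {set edge G} :=
  foldl (rom_step w) set0 (arrivals w).

Definition selection_prob (f : edge G) : R :=
  Pr [pred w | f \in attenuate_rom w].

End AttenuateROM.

Section Attenuation.
Variable R : realType.

Definition euler_e : R := expR 1.

(* Only the values on [0, 1] matter. *)
Definition a2 (x : R) : R :=
  if x == 1 then 4 / euler_e ^+ 2
  else (1 - x) ^+ 4 / (expR x - euler_e * x) ^+ 2.

Definition gamma : R :=
  (euler_e ^+ 6 + euler_e ^+ 4 - 42 - 4 * euler_e ^+ 2) / (2 * euler_e ^+ 6).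

End Attenuation.

(* Main.v *)
(* Put the arrival times on a fine grid, independently and uniformly: this
   perturbs the law of the arrival order by O(1/N).  When [f] arrives at time t,
   an end u of [f] is free if no other usable edge at u has arrived, or if exactly
   one has, [g], and [g] was blocked by an earlier edge [h] that was itself isolated
   on arrival.  Writing c = 2/e^2, the attenuation [a2] is chosen so that Jensen's
   inequality gives [g] a blocked weight at least c t^2 (1 - x g) whatever the
   weights around [g] are, so that u is free with probability at least about
   exp(-t (1 - x f)) (1 + c t^2 (1 - x f)).
   Without 3- and 5-cycles the events at the two ends of [f] are positively
   correlated, except when an edge k joins the far ends of [g] and [g'];  the event
   that k blocks both [g] and [g'] more than makes up for the patterns this excludes.
   Finally gamma is the integral over [0, 1] of exp(-2t) (1 + c t^2)^2. *)
Require Import Defs.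
From mathcomp Require Import all_boot all_order all_fingroup all_algebra reals.
From mathcomp Require Import sequences exp derive realfun topology normedtype.
From mathcomp Require Import bernoulli_distribution ring lra.
Import Order.TTheory GRing.Theory Num.Theory.
Import numFieldNormedType.Exports.
Set Implicit Arguments.
Unset Strict Implicit.
Unset Printing Implicit Defensive.
Local Open Scope ring_scope.

(** Pairs of certificates, one per end of [f], are split by grid times into cylinder events: a few
    named edges are usable at given times, and all others near certain vertices must not be usable
    too early. Several lateness conditions on one edge amount to the strictest, so a cylinder has at
    least the product of the probabilities of its conditions; this is the positive correlation. A
    triangle would let a blocker touch the other end of [f]; a pentagon would let the blockers of
    the two ends meet, and meeting edges cannot both be isolated. The one-end bound carries a
    correction [eta * D t], with [eta] the sum of the squared weights at that end. [D] is negative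
    after 2/3, so the correction is kept until the average over [t], where it only helps. The final
    numerical inequality is an equality at [x f = 0]; for larger [x f] the loss [a2 (x f)] is
    weighed against the lighter competition [1 - x f]. Integrals appear only as differences of
    antiderivatives, below left Riemann sums of decreasing functions. The change of arrival law
    costs K/N with K independent of N. *)

Module Calculus.

(** * Derivative rules and monotonicity *)

Section DerivativeRules.
Variable R : realType.
Implicit Types (f g : R -> R) (t a b c : R).

Definition has_der f t a : Prop := is_derive t 1 f a.

Lemma has_der_eq f t a b : has_der f t a -> a = b -> has_der f t b.
Proof. by move=> df <-. Qed.

Lemma has_der_cst t c : has_der (fun _ : R => c) t 0.
Proof. exact: is_derive_cst. Qed.

Lemma has_der_id t : has_der (fun u : R => u) t 1.
Proof. exact: is_derive_id. Qed.

Lemma has_derD f g t a b : has_der f t a -> has_der g t b ->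
  has_der (fun u => f u + g u) t (a + b).
Proof. by move=> df dg; exact: is_deriveD. Qed.

Lemma has_derN f t a : has_der f t a -> has_der (fun u => - f u) t (- a).
Proof. by move=> df; exact: is_deriveN. Qed.

Lemma has_derM f g t a b : has_der f t a -> has_der g t b ->
  has_der (fun u => f u * g u) t (a * g t + f t * b).
Proof.
move=> df dg; have := is_deriveM df dg.
by rewrite /has_der /GRing.scale /= addrC (mulrC a).
Qed.

Lemma has_der_expR f t a : has_der f t a ->
  has_der (fun u => expR (f u)) t (a * expR (f t)).
Proof.
by move=> df; have := is_derive1_comp (is_derive_expR (f t)) df; rewrite mulrC.
Qed.

Lemma nondecreasing_der f (df : R -> R) a b : a <= b ->
  (forall t, has_der f t (df t)) ->
  (forall t, a <= t <= b -> 0 <= df t) -> f a <= f b.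
Proof.
rewrite le_eqVlt => /predU1P[->//|ab dfE df0].
have dfE' t : t \in `]a, b[ -> is_derive t 1 f (df t) by move=> _; exact: dfE.
have [|c cab fE] := MVT ab dfE'.
  apply: continuous_subspaceT => y.
  by apply: differentiable_continuous; apply/derivable1_diffP; case: (dfE y).
rewrite -subr_ge0 fE; apply: mulr_ge0; last by rewrite subr_ge0 ltW.
apply: df0; by move: cab; rewrite in_itv /= => /andP[/ltW-> /ltW->].
Qed.

End DerivativeRules.

(** The patterns without a binder are the eta-reduced forms of negation, scaling, translation and
    the exponential. *)
Ltac der :=
  match goal with
  | |- has_der (fun u => u) _ _ => exact: has_der_id
  | |- has_der -%R _ _ => exact: (has_derN (has_der_id _))
  | |- has_der (GRing.mul ?c) _ _ => exact: (has_derM (has_der_cst _ c) (has_der_id _))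
  | |- has_der (+%R ?c) _ _ => exact: (has_derD (has_der_cst _ c) (has_der_id _))
  | |- has_der expR _ _ => exact: (has_der_expR (has_der_id _))
  | |- has_der (fun u => ?c) _ _ => exact: has_der_cst
  | |- has_der (fun u => _ + _) _ _ => apply: has_derD; der
  | |- has_der (fun u => - _) _ _ => apply: has_derN; der
  | |- has_der (fun u => _ * _) _ _ => apply: has_derM; der
  | |- has_der (fun u => expR _) _ _ => apply: has_der_expR; der
  end.

(** * Riemann sums, the transform [M], and numerical bounds for e and gamma *)

Section Analysis.
Variable R : realType.
Implicit Types (x y z t : R).

(** On each cell [dF] is at most the value of [L] at the left end, so there is no error term. Asking
    only [dF <= L] spares [L] an antiderivative of its own. *)
Lemma left_riemann_sum (F dF L : R -> R) (N : nat) : (0 < N)%N ->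
  (forall t, has_der F t (dF t)) ->
  (forall t, 0 <= t <= 1 -> dF t <= L t) ->
  (forall s t, 0 <= s -> s <= t -> t <= 1 -> L t <= L s) ->
  F 1 - F 0 <= N%:R^-1 * \sum_(i < N) L (i%:R / N%:R).
Proof.
move=> N0 dFE dFL Ldec.
have N0R : 0 < N%:R :> R by rewrite ltr0n.
have -> : F 1 - F 0 = \sum_(i < N) (F (i.+1%:R / N%:R) - F (i%:R / N%:R)).
  rewrite -(big_mkord xpredT (fun i => F (i.+1%:R / N%:R) - F (i%:R / N%:R))).
  rewrite telescope_sumr// mul0r divff//; exact: lt0r_neq0.
rewrite mulr_sumr; apply: ler_sum => i _.
set b := i.+1%:R / N%:R; set a := i%:R / N%:R.
have a0 : 0 <= a by rewrite divr_ge0.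
have b1 : b <= 1 by rewrite ler_pdivrMr// mul1r ler_nat.
have bE : b = a + N%:R^-1 by rewrite /b -natr1 mulrDl mul1r.
have ab : a <= b by rewrite bE lerDl invr_ge0 ltW.
have dG t : has_der (fun u => L a * u - F u) t (0 * t + L a * 1 - dF t).
  exact: (has_derD (has_derM (has_der_cst _ _) (has_der_id _)) (has_derN (dFE t))).
have H := nondecreasing_der ab dG.
suff : L a * a - F a <= L a * b - F b by rewrite bE; lra.
apply: H => t /andP[at_ tb]; rewrite mul0r add0r mulr1 subr_ge0.
apply: le_trans (dFL t _) _; first by apply/andP; split; lra.
by apply: Ldec => //; lra.
Qed.

(** The integral of [(1 - t) * expR (- (z * t))] over [0, 1]. *)
Definition M z : R := if z == 0 then 1 / 2 else (expR (- z) - 1 + z) / z ^+ 2.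

Lemma antiderivative_M z : exists2 K : R -> R,
  forall t, has_der K t ((1 - t) * expR (- (z * t))) & K 1 - K 0 = M z.
Proof.
rewrite /M; case: eqVneq => [->|z0].
  exists (fun t => t - t * t / 2) => [t|]; last by field.
  by apply: has_der_eq; [der|rewrite mul0r oppr0 expR0; field].
exists (fun t => (- ((1 - t) / z) + z^-1 * z^-1) * expR (- (z * t))) => [t|].
  by apply: has_der_eq; [der|rewrite /=; field].
by rewrite !mulr0 oppr0 expR0 mulr1; field.
Qed.

(** Doubling the last coefficient of the Taylor polynomial makes it an upper bound on [0, 1]:
    [P t * expR (- t)] increases there from 1. *)
Lemma euler_le : euler_e R <= 2 + 718 / 10 ^+ 3 + 283 / 10 ^+ 6.
Proof.
pose P t : R := 1 + t * (1 + t / 2 * (1 + t / 3 * (1 + t / 4 * (1 + t / 5 *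
  (1 + t / 6 * (1 + t / 7 * (1 + t / 8 * (1 + t / 9 * (1 + 2 * (t / 10)))))))))).
have dP t : has_der (fun t => P t * expR (- t)) t
    (t ^+ 9 * (1 - t / 5) / (2 * 3 * 4 * 5 * 6 * 7 * 8 * 9) * expR (- t)).
  by apply: has_der_eq; [rewrite /P; der|rewrite /=; field].
have : P 0 * expR (- 0) <= P 1 * expR (- 1).
  apply: (nondecreasing_der ler01 dP) => t /andP[t0 t1].
  rewrite mulr_ge0 ?expR_ge0// divr_ge0// mulr_ge0 ?exprn_ge0//; lra.
have -> : P 0 = 1 by rewrite /P; field.
rewrite oppr0 expR0 expRN ler_pdivlMr ?expR_gt0// !mul1r.
by move/le_trans; apply; rewrite /P; lra.
Qed.

Lemma euler_ge : 2 + 718 / 10 ^+ 3 + 281 / 10 ^+ 6 + 8 / 10 ^+ 7 <= euler_e R.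
Proof.
pose P t : R := 1 + t * (1 + t / 2 * (1 + t / 3 * (1 + t / 4 * (1 + t / 5 *
  (1 + t / 6 * (1 + t / 7 * (1 + t / 8 * (1 + t / 9 * (1 + t / 10))))))))).
have dP t : has_der (fun t => - (P t * expR (- t))) t
    (t ^+ 10 / (2 * 3 * 4 * 5 * 6 * 7 * 8 * 9 * 10) * expR (- t)).
  by apply: has_der_eq; [rewrite /P; der|rewrite /=; field].
have : - (P 0 * expR (- 0)) <= - (P 1 * expR (- 1)).
  apply: (nondecreasing_der ler01 dP) => t /andP[t0 t1].
  rewrite mulr_ge0 ?expR_ge0// divr_ge0 ?exprn_ge0//; lra.
have -> : P 0 = 1 by rewrite /P; field.
rewrite oppr0 expR0 expRN lerN2 ler_pdivrMr ?expR_gt0// !mul1r.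
by apply/le_trans; rewrite /P; lra.
Qed.

Lemma gamma_approx : `| gamma R - (478 / 10 ^+ 3 + 983 / 10 ^+ 6) | <= 1 / (2 * 10 ^+ 6).
Proof.
have e1 := euler_ge; have e2 := euler_le.
rewrite /gamma; move: (euler_e R) e1 e2 => e e1 e2.
have e0 : 0 < e by lra.
have -> : (e ^+ 6 + e ^+ 4 - 42 - 4 * e ^+ 2) / (2 * e ^+ 6) =
    1 / 2 + (e ^+ 2)^-1 / 2 - 2 * (e ^+ 2)^-1 ^+ 2 - 21 * (e ^+ 2)^-1 ^+ 3.
  by field; apply: lt0r_neq0.
have q1 : 135 / 10 ^+ 3 + 335 / 10 ^+ 6 <= (e ^+ 2)^-1.
  by rewrite -[leRHS]mul1r ler_pdivlMr ?exprn_gt0//; nra.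
(* Gamma falls as [q] grows, and it clears the lower end of the tolerance by less than 1 / 10^7;
   hence the seventh digit here. *)
have q2 : (e ^+ 2)^-1 <= 135 / 10 ^+ 3 + 335 / 10 ^+ 6 + 3 / 10 ^+ 7.
  by rewrite -[leLHS]mul1r ler_pdivrMr ?exprn_gt0//; nra.
move: (e ^+ 2)^-1 q1 q2 => q q1 q2.
by rewrite ler_norml; apply/andP; split; nra.
Qed.

End Analysis.

End Calculus.
Import Calculus.

(** * The attenuation function and the mean weight of a blocker *)

Module Attenuating.

Section Analysis2.
Variable R : realType.
Implicit Types (x y z t : R).
Local Notation e := (euler_e R).
Local Notation M := (@M R).
Local Notation a2 := (@a2 R).

Lemma euler_gt0 : 0 < e. Proof. exact: expR_gt0. Qed.

Lemma expR_1B x : expR (1 - x) = e * expR (- x).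
Proof. by rewrite expRD. Qed.

(** The value [4 / e ^+ 2] at 1 is the case [M 0 = 1 / 2], so one formula covers both branches of
    [a2]. *)
Lemma a2E x : a2 x = (e * M (1 - x)) ^- 2.
Proof.
have e0 := lt0r_neq0 euler_gt0.
rewrite /Defs.a2 /Calculus.M subr_eq0 eq_sym; case: eqVneq => [_|x1].
  by field.
have x1' : 1 - x != 0 by rewrite subr_eq0.
have -> : expR x = e * expR (- (1 - x)) by rewrite -expRD; congr expR; ring.
set E := expR _; rewrite -[in RHS]exprVn.
have -> : e * E - e * x = e * (E - 1 + (1 - x)) by ring.
(* With the convention that 0 has inverse 0, both sides vanish here. *)
have [->|D0] := eqVneq (E - 1 + (1 - x)) 0.
  by rewrite !(mulr0, mul0r, expr0n, invr0).
by field; rewrite e0 x1' D0.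
Qed.

(** [e * M (1 - x)] is the integral of [(1 - t) * expR (1 - (1 - x) * t)], so a pointwise comparison
    of integrands suffices. *)
Lemma M_le x (F dF : R -> R) : (forall t, has_der F t (dF t)) ->
  (forall t, 0 <= t <= 1 -> (1 - t) * expR (1 - (1 - x) * t) <= dF t) ->
  e * M (1 - x) <= F 1 - F 0.
Proof.
move=> dFE leF; have [K dK <-] := antiderivative_M (1 - x).
have d t : has_der (fun u => F u - e * K u) t
    (dF t - (0 * K t + e * ((1 - t) * expR (- ((1 - x) * t))))).
  exact: (has_derD (dFE t) (has_derN (has_derM (has_der_cst _ _) (dK t)))).
have : F 0 - e * K 0 <= F 1 - e * K 1; last by lra.
apply: (nondecreasing_der ler01 d) => t /leF.
by rewrite expR_1B subr_ge0 mul0r add0r mulrCA.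
Qed.

Lemma M_ge x (F dF : R -> R) : (forall t, has_der F t (dF t)) ->
  (forall t, 0 <= t <= 1 -> dF t <= (1 - t) * expR (1 - (1 - x) * t)) ->
  F 1 - F 0 <= e * M (1 - x).
Proof.
move=> dFE leF; have [K dK <-] := antiderivative_M (1 - x).
have d t : has_der (fun u => e * K u - F u) t
    ((0 * K t + e * ((1 - t) * expR (- ((1 - x) * t)))) - dF t).
  exact: (has_derD (has_derM (has_der_cst _ _) (dK t)) (has_derN (dFE t))).
have : e * K 0 - F 0 <= e * K 1 - F 1; last by lra.
apply: (nondecreasing_der ler01 d) => t /leF.
by rewrite expR_1B subr_ge0 mul0r add0r mulrCA.
Qed.

Lemma expR_chord x t : 0 <= x <= 1 -> 0 <= t ->
  expR (x * t) <= 1 + x * (expR t - 1).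
Proof.
move=> /andP[x0 x1] t0.
have d (u : R) : has_der (fun u => x * (expR u - 1) - expR (x * u)) u
    (x * (expR u - expR (x * u))).
  by apply: has_der_eq; [der|rewrite /=; field].
have : x * (expR 0 - 1) - expR (x * 0) <= x * (expR t - 1) - expR (x * t).
  apply: (nondecreasing_der t0 d) => u /andP[u0 _].
  by rewrite mulr_ge0// subr_ge0 ler_expR ler_piMl.
by rewrite mulr0 expR0; lra.
Qed.

(** This is [expR_chord] integrated from 0 to [t]. *)
Lemma expR_chord2 x t : 0 <= x <= 1 -> 0 <= t ->
  expR (x * t) <= 1 + x * t + x ^+ 2 * (expR t - 1 - t).
Proof.
move=> x01 t0; have /andP[x0 x1] := x01.
have d (u : R) : has_der (fun u => x * x * (expR u - 1 - u) + x * u - expR (x * u)) u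
    (x * (1 + x * (expR u - 1) - expR (x * u))).
  by apply: has_der_eq; [der|rewrite /=; field].
have : x * x * (expR 0 - 1 - 0) + x * 0 - expR (x * 0)
    <= x * x * (expR t - 1 - t) + x * t - expR (x * t).
  apply: (nondecreasing_der t0 d) => u /andP[u0 _].
  by rewrite mulr_ge0// subr_ge0 expR_chord.
by rewrite mulr0 expR0; lra.
Qed.

(** Apply [expR_chord2] under the integral. The quadratic is exact at 0 and at 1 and has the right
    slope [3 - e] at 0. *)
Lemma M_upper x : 0 <= x <= 1 ->
  e * M (1 - x) <= 1 + (3 - e) * x + (3 * e / 2 - 4) * x ^+ 2.
Proof.
move=> x01; pose al := 1 - x ^+ 2; pose be := x - x ^+ 2.
pose F t := (be + (al + be) * t + be * (t * t)) * expR (1 - t)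
  + x ^+ 2 * e * (t - t * t / 2).
have -> : 1 + (3 - e) * x + (3 * e / 2 - 4) * x ^+ 2 = F 1 - F 0.
  by rewrite /F subrr expR0 subr0 -/e /al /be; field.
have d t : has_der F t
    ((1 - t) * ((al + be * t) * expR (1 - t) + x ^+ 2 * e)).
  by apply: has_der_eq; [rewrite /F; der|rewrite /=; field].
apply: (M_le d) => t /andP[t0 t1].
have -> : 1 - (1 - x) * t = x * t + (1 - t) by ring.
have -> : e = expR t * expR (1 - t) by rewrite -expRD addrC subrK.
rewrite expRD ler_wpM2l ?subr_ge0// mulrA -mulrDl ler_wpM2r ?expR_ge0//.
by have := expR_chord2 x01 t0; rewrite /al /be; lra.
Qed.

(** Jensen: [(1 - t) * expR (1 - t)] is a probability density on [0, 1] with mean [3 - e], and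
    28/100 rounds this mean down. *)
Lemma M_lower x : 0 <= x <= 1 -> expR (28 / 100 * x) <= e * M (1 - x).
Proof.
move=> /andP[x0 x1]; pose m : R := 28 / 100; pose E := expR (m * x).
pose al := 1 - m * x.
pose F t := E * ((x + (al + x) * t + x * (t * t)) * expR (1 - t)).
have d t : has_der F t (E * ((1 - t) * (al + x * t) * expR (1 - t))).
  by apply: has_der_eq; [rewrite /F; der|rewrite /=; field].
apply: le_trans (_ : F 1 - F 0 <= _).
  rewrite /F subrr expR0 subr0 -/e -/m -/E /al.
  rewrite [leRHS](_ : _ = E * (1 + x * (3 - e - m))); last by field.
  rewrite ler_peMr ?expR_ge0// lerDl mulr_ge0//.
  by have := euler_le R; rewrite /m; lra.
apply: (M_ge d) => t /andP[t0 t1].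
have -> : 1 - (1 - x) * t = m * x + (x * (t - m) + (1 - t)) by ring.
rewrite (expRD (m * x)) (expRD (x * _)) -/E [leRHS]mulrCA -!mulrA ler_wpM2l ?expR_ge0// ler_wpM2l ?subr_ge0//.
rewrite ler_wpM2r ?expR_ge0//; apply: le_trans (expR_ge1Dx _).
by rewrite /al; lra.
Qed.

Lemma M_gt0 x : 0 <= x <= 1 -> 0 < e * M (1 - x).
Proof. by move/M_lower; apply: lt_le_trans; exact: expR_gt0. Qed.

Lemma a2_gt0 x : 0 <= x <= 1 -> 0 < a2 x.
Proof. by move=> x01; rewrite a2E invr_gt0 exprn_gt0// M_gt0. Qed.

Lemma a2_upper x : 0 <= x <= 1 -> a2 x <= expR (- (56 / 100 * x)).
Proof.
move=> x01; rewrite a2E expRN lef_pV2 ?posrE ?expR_gt0 ?exprn_gt0 ?M_gt0//.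
have -> : 56 / 100 * x = 28 / 100 * x + 28 / 100 * x by lra.
rewrite expRD -expr2 lerXn2r ?nnegrE ?expR_ge0 ?M_lower//.
exact/ltW/M_gt0.
Qed.

Lemma a2_le1 x : 0 <= x <= 1 -> a2 x <= 1.
Proof.
move=> x01; apply: le_trans (a2_upper x01) _.
by rewrite -[leRHS]expR0 ler_expR; case/andP: x01 => x0 _; lra.
Qed.

Definition c : R := 2 / e ^+ 2.

(** With [z = t * x <= x], [a2_upper] gives [a2 x <= expR (- (z / 2))], and what remains is
    [z <= expR (z / 2) - expR (- (z / 2))]. *)
Lemma survival x t : 0 <= x <= 1 -> 0 <= t <= 1 ->
  expR (- (t * x)) <= 1 - t * (x * a2 x).
Proof.
move=> x01 /andP[t0 t1]; have /andP[x0 x1] := x01.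
pose z := t * x; have z0 : 0 <= z by rewrite mulr_ge0.
have zx : z <= x by rewrite /z ler_piMl.
apply: (@le_trans _ _ (1 - z * expR (- (z / 2)))); last first.
  rewrite mulrA -/z lerB// ler_wpM2l//; apply: le_trans (a2_upper x01) _.
  by rewrite ler_expR; lra.
have d (u : R) : has_der (fun u => expR (u / 2) - expR (- (u / 2)) - u) u
    ((expR (u / 2) + expR (- (u / 2))) / 2 - 1).
  by apply: has_der_eq; [der|rewrite /=; field].
have : expR (0 / 2) - expR (- (0 / 2)) - 0 <= expR (z / 2) - expR (- (z / 2)) - z.
  apply: (nondecreasing_der z0 d) => u _.
  by have := expR_ge1Dx (u / 2); have := expR_ge1Dx (- (u / 2)); lra.
rewrite mul0r oppr0 subrr addr0 => h.
have E1 := expRxMexpNx_1 (z / 2).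
have -> : expR (- (t * x)) = expR (- (z / 2)) * expR (- (z / 2)).
  by rewrite -expRD; congr expR; rewrite /z; field.
move: h E1 (expR_ge0 (- (z / 2))).
move: (expR (z / 2)) (expR (- (z / 2))) => A B; nra.
Qed.

Lemma c_bounds : 2706 / 10 ^+ 4 <= c <= 2707 / 10 ^+ 4.
Proof.
have e1 := euler_ge R; have e2 := euler_le R; have e0 := euler_gt0.
have E0 : 0 < e ^+ 2 by rewrite exprn_gt0.
have l : 7389 / 10 ^+ 3 <= e ^+ 2 by nra.
have u : e ^+ 2 <= 739 / 10 ^+ 2 by nra.
by apply/andP; rewrite /c; split; [rewrite ler_pdivlMr|rewrite ler_pdivrMr]; lra.
Qed.

(* Jensen: [exp(-2yt) >= 2 l exp(-yt) - l^2] with [l = 2 M y]; this is what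
   [a2] is made for. *)
Lemma M_double y : 2 * (M y) ^+ 2 <= M (2 * y).
Proof.
have [K dK KE] := antiderivative_M y.
have [K2 dK2 K2E] := antiderivative_M (2 * y).
pose l := 2 * M y.
have d t : has_der (fun u => K2 u - 2 * l * K u + l * l * (u - u * u / 2)) t
    ((1 - t) * (expR (- (y * t)) - l) ^+ 2).
  apply: has_der_eq.
    apply: has_derD; last by der.
    exact: (has_derD (dK2 t) (has_derN (has_derM (has_der_cst _ _) (dK t)))).
  have -> : - (2 * y * t) = - (y * t) + - (y * t) by ring.
  by rewrite expRD /=; field.
have : K2 0 - 2 * l * K 0 + l * l * (0 - 0 * 0 / 2)
    <= K2 1 - 2 * l * K 1 + l * l * (1 - 1 * 1 / 2).
  apply: (nondecreasing_der ler01 d) => t /andP[t0 t1].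
  by rewrite mulr_ge0 ?subr_ge0// sqr_ge0.
by rewrite -K2E /l expr2; move: KE; move: (M y) => m <-; nra.
Qed.

Lemma mean_decreasing_ge y (i : nat) : 0 <= y -> (0 < i)%N ->
  M y <= i%:R^-1 * \sum_(j < i) (1 - j%:R / i%:R) * expR (- (y * (j%:R / i%:R))).
Proof.
move=> y0 i0; have [K dK <-] := antiderivative_M y.
apply: (left_riemann_sum (L := fun s => (1 - s) * expR (- (y * s))) i0 dK) => //.
move=> s t s0 st t1; apply: ler_pM; rewrite ?subr_ge0 ?expR_ge0//; first by lra.
by rewrite ler_expR lerN2 ler_wpM2l.
Qed.

(* Lower bound for the rate at which the edge [g] arriving at time [t = i/N] is
   preceded by an isolated blocker of weight [x]. *)
Lemma blocker_mean x (i : nat) : 0 <= x <= 1 -> (0 < i)%N ->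
  c <= a2 x * (i%:R^-1 * \sum_(j < i)
    (1 - j%:R / i%:R) * expR (- (2 * (1 - x) * (j%:R / i%:R)))).
Proof.
move=> x01 i0; have /andP[x0 x1] := x01.
have M0 := M_gt0 x01; have e0 := euler_gt0.
have M1 : 0 < M (1 - x) by move: M0; rewrite pmulr_rgt0.
have -> : c = a2 x * (2 * (M (1 - x)) ^+ 2).
  by rewrite a2E /c; field; rewrite !lt0r_neq0.
rewrite ler_wpM2l ?(ltW (a2_gt0 x01))//; apply: le_trans (M_double _) _.
by apply: mean_decreasing_ge => //; lra.
Qed.

Lemma sum_ord_natr (n : nat) : \sum_(j < n) j%:R = n%:R * (n%:R - 1) / 2 :> R.
Proof.
elim: n => [|n IH]; first by rewrite big_ord0 !mul0r.
by rewrite big_ord_recr /= IH -natr1; field.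
Qed.

Lemma sum_ord_natr_sqr (n : nat) :
  \sum_(j < n) j%:R ^+ 2 = n%:R * (n%:R - 1) * (2 * n%:R - 1) / 6 :> R.
Proof.
elim: n => [|n IH]; first by rewrite big_ord0 !mul0r.
by rewrite big_ord_recr /= IH -natr1; field.
Qed.

(* Chebyshev: [(1 - s)^2 A^2 >= 2/3 (1 - s) A^2 + (1 - s)(1/3 - s) A(1/3)^2]. *)
Lemma double_blocker_mean x (i : nat) : 0 <= x <= 1 -> (0 < i)%N ->
  2 / 3 * c <= a2 x * (i%:R^-1 * \sum_(j < i)
    (1 - j%:R / i%:R) ^+ 2 * expR (- (2 * (1 - x) * (j%:R / i%:R)))).
Proof.
move=> x01 i0; have := blocker_mean x01 i0; have /andP[x0 x1] := x01.
have i0R : 0 < i%:R :> R by rewrite ltr0n.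
set S1 := _ * \sum_(j < i) _; set S2 := _ * \sum_(j < i) _ => cS.
suff : 2 / 3 * S1 <= S2.
  move=> S12; apply: (@le_trans _ _ (2 / 3 * (a2 x * S1))).
    by rewrite ler_wpM2l// divr_ge0.
  by rewrite mulrCA ler_wpM2l// ltW// a2_gt0.
pose A s := expR (- (2 * (1 - x) * s)).
(* [(1 - s) * (1 / 3 - s)] has integral 0 over [0, 1]; its mean over the grid [j / i] is exactly
   [(1 / i) * (1 + 1 / i) / 6]. *)
have C0 : 0 <= i%:R^-1 * \sum_(j < i)
    ((1 - j%:R / i%:R) * (1 / 3 - j%:R / i%:R)) * A (1 / 3).
  rewrite -mulr_suml mulrA mulr_ge0 ?expR_ge0//.
  have -> : \sum_(j < i) ((1 - j%:R / i%:R) * (1 / 3 - j%:R / i%:R)) =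
      1 / 3 * (\sum_(j < i) 1) - 4 / 3 * (\sum_(j < i) j%:R) / i%:R
      + (\sum_(j < i) j%:R ^+ 2) / i%:R ^+ 2 :> R.
    rewrite !mulr_sumr !mulr_suml -sumrB.
    rewrite -big_split /=; apply: eq_bigr => j _; field; exact: lt0r_neq0.
  rewrite sumr_const card_ord sum_ord_natr sum_ord_natr_sqr.
  rewrite [leRHS](_ : _ = (i%:R^-1 / 6) * (1 + i%:R^-1)).
    by rewrite mulr_ge0 ?addr_ge0 ?divr_ge0 ?invr_ge0 ?ltW.
  by field; exact: lt0r_neq0.
rewrite -subr_ge0; apply: le_trans C0 _.
rewrite /S2 /S1 (mulrCA (2 / 3)) -mulrBr ler_wpM2l ?invr_ge0 ?(ltW i0R)// mulr_sumr -sumrB.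
apply: ler_sum => j _; set s := _ / _; rewrite -/(A s).
have s1 : s <= 1 by rewrite ler_pdivrMr// mul1r ler_nat ltnW.
rewrite -subr_ge0 [leRHS](_ : _ = (1 - s) * ((1 / 3 - s) * (A s - A (1 / 3)))).
  rewrite mulr_ge0 ?subr_ge0//.
  have [s3|s3] := lerP s (1 / 3).
    by rewrite mulr_ge0 ?subr_ge0// /A ler_expR lerN2 ler_wpM2l//; lra.
  rewrite -mulrNN mulr_ge0 ?opprB ?subr_ge0 ?(ltW s3)//.
  by rewrite /A ler_expR lerN2 ler_wpM2l ?(ltW s3)//; lra.
by field.
Qed.

End Analysis2.

End Attenuating.
Import Attenuating.

(** * The contribution of a single edge at an end of [f] *)

Module Slack.

Section Analysis3.
Variable R : realType.
Implicit Types (x y z t w : R).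
Local Notation e := (euler_e R).
Local Notation M := (@M R).
Local Notation a2 := (@a2 R).
Local Notation c := (@c R).

Lemma expR_ge_cubic z : 0 <= z -> 1 + z + z ^+ 2 / 2 + z ^+ 3 / 6 <= expR z.
Proof.
move=> z0.
have d (u : R) : has_der
    (fun u => - ((1 + u + u * u / 2 + u * u * u / 6) * expR (- u))) u
    (u * u * u / 6 * expR (- u)).
  by apply: has_der_eq; [der|rewrite /=; field].
have := nondecreasing_der z0 d; rewrite oppr0 expR0 lerN2 !mul0r !addr0 mulr1.
rewrite expRN ler_pdivrMr ?expR_gt0// mul1r !exprS expr0 mulr1 !mulrA; apply.
by move=> t /andP[t0 _]; rewrite mulr_ge0 ?expR_ge0// divr_ge0 ?mulr_ge0.
Qed.

(** The threshold is [1 - 56 / 100], the largest exponent [x * (t - 56 / 100)] met in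
    [edge_slack]. *)
Lemma expR_le_quadratic w : w <= 44 / 100 ->
  expR w <= 1 + w + 59 / 100 * w ^+ 2.
Proof.
move=> w44; have [w0|/ltW w0] := lerP w 0.
  have d (u : R) : has_der
      (fun u => - ((1 + u + u * u / 2) * expR (- u))) u
      (u * u / 2 * expR (- u)).
    by apply: has_der_eq; [der|rewrite /=; field].
  have := nondecreasing_der w0 d; rewrite oppr0 expR0 lerN2 !mul0r !addr0 mulr1.
  rewrite expRN ler_pdivlMr ?expR_gt0// mul1r => H.
  apply: le_trans (H _) _; last by nra.
  by move=> t _; rewrite mulr_ge0 ?expR_ge0// divr_ge0// -expr2 sqr_ge0.
have d (u : R) : has_der
    (fun u => (1 + u + u * u / 2 + u * u * u / 5) * expR (- u)) u
    (u * u * (1 / 10 - u / 5) * expR (- u)).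
  by apply: has_der_eq; [der|rewrite /=; field].
have := nondecreasing_der w0 d; rewrite oppr0 expR0 !mul0r !addr0 mulr1.
rewrite expRN ler_pdivlMr ?expR_gt0// (mul1r (expR w)) => H.
apply: le_trans (H _) _; last by nra.
move=> t /andP[t0 tw]; rewrite mulr_ge0 ?expR_ge0// mulr_ge0 ?mulr_ge0//; lra.
Qed.

(* Slack polynomial; any function with a positive mean against decreasing
   weights and below the true slack would do. *)
Definition D t : R := 9 / 50 * (t * (2 - 3 * t)).

(** The right side is what one edge of weight [x] adds after [expR (- t y)] is factored out: its
    excess over exponential survival, plus its blocked share, minus its part of the target
    [c * t ^+ 2 * y]. *)
Lemma edge_slack x t : 0 <= x <= 1 -> 0 <= t <= 1 ->
  x ^+ 2 * D t <= (1 - t * (x * a2 x)) * expR (t * x) - 1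
    + c * t ^+ 2 * (x * a2 x) * (1 - x) * expR (t * x) - c * t ^+ 2 * x.
Proof.
move=> x01 /andP[t0 t1]; have /andP[x0 x1] := x01.
have /andP[c1 c2] := c_bounds R.
pose z := t * x; have z0 : 0 <= z by rewrite mulr_ge0.
have zt : z <= t by rewrite /z ler_piMr.
pose w := x * (t - 56 / 100).
have E1 : a2 x * expR z <= 1 + w + 59 / 100 * w ^+ 2.
  apply: (@le_trans _ _ (expR w)); last first.
    by apply: expR_le_quadratic; rewrite /w; nra.
  have -> : w = - (56 / 100 * x) + z by rewrite /w /z; ring.
  by rewrite expRD ler_wpM2r ?expR_ge0// a2_upper.
have E2 := expR_ge_cubic z0.
have k0 : 0 <= 1 - c * t + c * z by nra.
have V0 : 0 <= t / 2 - 9 / 50 * (2 - 3 * t) - (t - 56 / 100) * (1 - c * t) - c * t.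
  have h : 0 <= (2707 / 10 ^+ 4 - c) * (t * (156 / 100 - t)).
    by rewrite mulr_ge0 ?mulr_ge0 ?subr_ge0//; lra.
  have := sqr_ge0 (t - 7 / 10); move: (c) c1 c2 h => k *; lra.
have V1 : 0 <= t / 2 + t ^+ 2 / 6 - 9 / 50 * (2 - 3 * t)
   - (t - 56 / 100) * (1 + 59 / 100 * (t - 56 / 100)) - c * t.
  have h : 0 <= (2707 / 10 ^+ 4 - c) * t by rewrite mulr_ge0 ?subr_ge0.
  have : 0 <= t * (1 - t) by rewrite mulr_ge0 ?subr_ge0.
  by move: (c) h => k; lra.
(* Divided by [x], this is quadratic and concave in [x], with value [V0] at 0 and [V1] at 1; [V2] is
   its excess over the chord. *)
have V : 0 <= 1 + z / 2 + z ^+ 2 / 6 - c * t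
    - (1 + w + 59 / 100 * w ^+ 2) * (1 - c * t + c * z)
    - 9 / 50 * (2 * x - 3 * z).
  have V2 : 0 <= 59 / 100 * (t - 56 / 100) ^+ 2 * (c * t) * (x * (1 - x)).
    have c0 : 0 <= c by lra.
    have x1' : 0 <= 1 - x by lra.
    apply: mulr_ge0 (mulr_ge0 x0 x1'); apply: mulr_ge0 (mulr_ge0 c0 t0).
    by apply: mulr_ge0 (sqr_ge0 _); lra.
  have {}V0 := mulr_ge0 x0 (mulr_ge0 (_ : 0 <= 1 - x) V0).
  have {}V1 := mulr_ge0 x0 (mulr_ge0 x0 V1).
  have {}V2 := mulr_ge0 x0 V2.
  have := addr_ge0 (addr_ge0 (V0 _) V1) V2; rewrite subr_ge0 => /(_ x1).
  by congr (0 <= _); rewrite /w /z; field.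
have V' := mulr_ge0 z0 V; have E1' := ler_wpM2l (mulr_ge0 z0 k0) E1.
rewrite -/z; move: E1 E1' E2 V'; set A := a2 x; set E := expR z => E1 E1' E2 V'.
have -> : x ^+ 2 * D t = z * (9 / 50 * (2 * x - 3 * z)) by rewrite /z /D; field.
have -> : (1 - t * (x * A)) * E - 1 + c * t ^+ 2 * (x * A) * (1 - x) * E
   - c * t ^+ 2 * x = E - 1 - z * (1 - c * t + c * z) * (A * E) - z * (c * t).
  by rewrite /z; ring.
move: E1' V' E2; rewrite !exprS expr0; move: (A * E) (1 - c * t + c * z) => AE k.
nra.
Qed.

(** Lower bound for the probability that an end is free at time [t], when the other edges there have
    total weight [y] and sum of squares [eta]. *)
Definition B y eta t : R := expR (- (t * y)) * (1 + c * t ^+ 2 * y + eta * D t).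

End Analysis3.

End Slack.
Import Slack.

(** * The one-end bound and its integral against gamma *)

Module Bounds.

Section Analysis4.
Variable R : realType.
Implicit Types (x y z t w : R).
Local Notation e := (euler_e R).
Local Notation M := (@M R).
Local Notation a2 := (@a2 R).
Local Notation c := (@c R).

Definition miss t x : R := 1 - t * (x * a2 x).

(** Write each [miss] as [expR (- (t * p g)) * (1 + d g)] with [d g >= 0]. The full product keeps
    [1 + \sum d g], the products without [g] keep only the exponentials, and [edge_slack] is summed
    over [g]. *)
Lemma side_bound (I : finType) (P : pred I) (p : I -> R) t :
  (forall g, 0 <= p g <= 1) -> 0 <= t <= 1 ->
  @B R (\sum_(g | P g) p g) (\sum_(g | P g) p g ^+ 2) t
  <= \prod_(g | P g) miss t (p g) +
     \sum_(g | P g) \prod_(g' | P g' && (g' != g)) miss t (p g')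
       * (p g * a2 (p g) * (c * t ^+ 2 * (1 - p g))).
Proof.
move=> p01 t01; have /andP[t0 t1] := t01.
have /andP[c1 _] := c_bounds R; have c0 : 0 <= c by lra.
pose d g : R := miss t (p g) * expR (t * p g) - 1.
have S g := survival (p01 g) t01.
have d0 g : 0 <= d g.
  by rewrite subr_ge0 -ler_pdivrMr ?expR_gt0// mul1r -expRN.
have dE g : miss t (p g) = expR (- (t * p g)) * (1 + d g).
  by rewrite /d (addrC 1 (_ - 1)) subrK [RHS]mulrCA -expRD addNr expR0 mulr1.
have prod_exp (Q : pred I) : \prod_(g | Q g) expR (- (t * p g)) =
    expR (- (t * \sum_(g | Q g) p g)).
  by rewrite mulr_sumr -sumrN expR_sum.
have ge1 (r : seq I) (Q : pred I) :
    1 + \sum_(g <- r | Q g) d g <= \prod_(g <- r | Q g) (1 + d g).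
  elim: r => [|g r IH]; first by rewrite !big_nil addr0.
  rewrite !big_cons; case: ifP => // _.
  have s0 : 0 <= \sum_(g <- r | Q g) d g by exact: sumr_ge0.
  by have := d0 g; nra.
rewrite /B; set y := \sum_(g | P g) p g.
apply: (@le_trans _ _ (expR (- (t * y)) * (1 + \sum_(g | P g) d g) +
   \sum_(g | P g) (expR (- (t * y)) * expR (t * p g)) * (p g * a2 (p g) *
     (c * t ^+ 2 * (1 - p g))))).
  have -> : \sum_(g | P g) (expR (- (t * y)) * expR (t * p g)) * (p g * a2 (p g) *
     (c * t ^+ 2 * (1 - p g))) = expR (- (t * y)) * \sum_(g | P g)
       expR (t * p g) * (p g * a2 (p g) * (c * t ^+ 2 * (1 - p g))).
    by rewrite [RHS]mulr_sumr; apply: eq_bigr => g _; rewrite [RHS]mulrA.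
  rewrite -mulrDr ler_wpM2l ?expR_ge0// -!addrA lerD2l.
  rewrite /y mulr_sumr mulr_suml -!big_split /=; apply: ler_sum => g _.
  by have := edge_slack (p01 g) t01; rewrite /d /miss; lra.
apply: lerD.
  have -> : \prod_(g | P g) miss t (p g) =
      expR (- (t * y)) * \prod_(g | P g) (1 + d g).
    by rewrite -prod_exp -big_split /=; apply: eq_bigr => g _; exact: dE.
  by rewrite ler_wpM2l ?expR_ge0.
apply: ler_sum => g Pg.
have /andP[pg0 pg1] := p01 g; have ag := ltW (a2_gt0 (p01 g)).
apply: ler_wpM2r; first by
  apply: mulr_ge0 (mulr_ge0 pg0 ag) _; apply: mulr_ge0; [exact: mulr_ge0 c0 (sqr_ge0 t)|rewrite subr_ge0].
have -> : expR (- (t * y)) * expR (t * p g) =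
    \prod_(g' | P g' && (g' != g)) expR (- (t * p g')).
  by rewrite prod_exp -expRD; congr expR; rewrite /y (bigD1 g)//=; ring.
by apply: ler_prod => g' _; rewrite expR_ge0 S.
Qed.

(** [D] has integral 0 over [0, 1], so the sign comes from the exact value of the grid sum. *)
Lemma sum_D_ge0 (N : nat) : 0 <= \sum_(i < N) D (i%:R / N%:R) :> R.
Proof.
case: N => [|N]; first by rewrite big_ord0.
have N0 : 0 < N.+1%:R :> R by rewrite ltr0n.
have -> : \sum_(i < N.+1) D (i%:R / N.+1%:R) = 9 / 50 * (2 *
    (\sum_(i < N.+1) i%:R) / N.+1%:R
    - 3 * (\sum_(i < N.+1) i%:R ^+ 2) / N.+1%:R ^+ 2) :> R.
  rewrite !mulr_sumr !mulr_suml -sumrB mulr_sumr; apply: eq_bigr => i _.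
  by move: (N.+1%:R) N0 => n n0; rewrite /D; field; exact: lt0r_neq0.
rewrite sum_ord_natr sum_ord_natr_sqr.
rewrite [leRHS](_ : _ = 9 / 50 * (N%:R / (2 * N.+1%:R))).
  by rewrite mulr_ge0 ?divr_ge0 ?mulr_ge0.
have n0 : N%:R + 1 != 0 :> R by rewrite natr1 lt0r_neq0.
by rewrite -[N.+1%:R]natr1; move: (N%:R) n0 => n n0; field.
Qed.

(** Here [q] stands for [e ^- 2] and [k] for [e]. Both sides agree at [x = 0], so [x] factors out of
    the difference; the cofactor has coefficients at least 0.039, 0.031, -0.069 and 0, and is
    positive on [0, 1]. *)
Lemma quartic_slack (q k x : R) :
  135 / 10 ^+ 3 + 335 / 10 ^+ 6 <= q -> q <= 135 / 10 ^+ 3 + 336 / 10 ^+ 6 ->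
  2718 / 10 ^+ 3 <= k -> k <= 2718 / 10 ^+ 3 + 3 / 10 ^+ 4 -> 0 <= x -> x <= 1 ->
  let g := 1 / 2 + q / 2 - 2 * q ^+ 2 - 21 * q ^+ 3 in
  g * (1 + (3 - k) * x + (3 * k / 2 - 4) * x ^+ 2) ^+ 2 <= g
    + (1 / 2 + q / 2 - 5 * q ^+ 2 - 67 * q ^+ 3) * x
    + (1 / 2 + q / 2 - 5 * q ^+ 2 - 134 * q ^+ 3) * x ^+ 2
    - (6 * q + 33 * q ^+ 2 - 553 * q ^+ 3) * x ^+ 3
    + (45 * q ^+ 2 - 331 * q ^+ 3) * x ^+ 4.
Proof.
move=> q1 q2 k1 k2 x0 x1; set g := (X in let g := X in _); rewrite /=.
have q2a : 1831 / 10 ^+ 5 <= q ^+ 2 by clear -q1 q2; nra.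
have q2b : q ^+ 2 <= 1832 / 10 ^+ 5 by clear -q1 q2; nra.
have q3a : 2478 / 10 ^+ 6 <= q ^+ 3 by rewrite exprS; clear -q1 q2 q2a; nra.
have q3b : q ^+ 3 <= 2479 / 10 ^+ 6 by rewrite exprS; clear -q1 q2 q2b; nra.
have ga : 0 <= g by rewrite /g; clear -q1 q2b q3b; lra.
have gb : g <= 4791 / 10 ^+ 4 by rewrite /g; clear -q2 q2a q3a; lra.
pose l := 3 - k; pose r := 3 * k / 2 - 4.
have la : 0 <= l by rewrite /l; clear -k2; lra.
have lb : l <= 282 / 10 ^+ 3 by rewrite /l; clear -k1; lra.
have ra : 0 <= r by rewrite /r; clear -k1; lra.
have rb : r <= 775 / 10 ^+ 4 by rewrite /r; clear -k2; lra.
have gl : g * l <= 4791 / 10 ^+ 4 * (282 / 10 ^+ 3) by exact: ler_pM.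
have gr : g * r <= 4791 / 10 ^+ 4 * (775 / 10 ^+ 4) by exact: ler_pM.
have gll : g * l * l <= 4791 / 10 ^+ 4 * (282 / 10 ^+ 3) * (282 / 10 ^+ 3).
  by apply: ler_pM => //; exact: mulr_ge0.
have glr : g * l * r <= 4791 / 10 ^+ 4 * (282 / 10 ^+ 3) * (775 / 10 ^+ 4).
  by apply: ler_pM => //; exact: mulr_ge0.
have grr : g * r * r <= 4791 / 10 ^+ 4 * (775 / 10 ^+ 4) * (775 / 10 ^+ 4).
  by apply: ler_pM => //; exact: mulr_ge0.
have v0 : 39 / 10 ^+ 3 <= 1 / 2 + q / 2 - 5 * q ^+ 2 - 67 * q ^+ 3 - 2 * (g * l).
  by clear -q1 q2b q3b gl; move: (g * l) (q ^+ 2) (q ^+ 3) gl q2b q3b => *; lra.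
have v1 : 31 / 10 ^+ 3 <= 1 / 2 + q / 2 - 5 * q ^+ 2 - 134 * q ^+ 3
    - (2 * (g * r) + g * l * l).
  clear -q1 q2b q3b gr gll.
  by move: (g * l * l) (g * r) (q ^+ 2) (q ^+ 3) gll gr q2b q3b => *; lra.
have v2 : - (69 / 10 ^+ 3) <= - (6 * q + 33 * q ^+ 2 - 553 * q ^+ 3)
    - 2 * (g * l * r).
  by clear -q2 q2b q3a glr; move: (g * l * r) (q ^+ 2) (q ^+ 3) glr q2b q3a => *; lra.
have v3 : 0 <= 45 * q ^+ 2 - 331 * q ^+ 3 - g * r * r.
  by clear -q2a q3b grr; move: (g * r * r) (q ^+ 2) (q ^+ 3) grr q2a q3b => *; lra.
rewrite -subr_ge0.
set u0 := (X in _ <= X) in v0; set u1 := (X in _ <= X) in v1.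
set u2 := (X in _ <= X) in v2; set u3 := (X in _ <= X) in v3.
rewrite [leRHS](_ : _ = x * (u0 + u1 * x + u2 * x ^+ 2 + u3 * x ^+ 3)); last first.
  by rewrite /u0 /u1 /u2 /u3 /l /r; ring.
have := mulr_ge0 v3 (exprn_ge0 3 x0); move: u0 u1 u2 (u3 * _) v0 v1 v2.
clear -x0 x1 => u0 u1 u2 w *; apply: mulr_ge0 => //.
have xx : x ^+ 2 <= x by rewrite expr2 ler_piMr.
have : 0 <= (u2 + 69 / 10 ^+ 3) * x ^+ 2 by rewrite mulr_ge0 ?sqr_ge0//; lra.
have : 0 <= (u1 - 31 / 10 ^+ 3) * x by rewrite mulr_ge0//; lra.
by move: (x ^+ 2) xx => X2 xx; lra.
Qed.

(** The square contains [expR (2 * (t * x))]. Replacing it by its quadratic Taylor polynomial leaves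
    a polynomial times [expR (- (2 * t))], which has a closed antiderivative. At [x = 0] nothing is
    lost and [F 1 - F 0] is gamma. *)
Lemma main_integral x : 0 <= x <= 1 ->
  let y := 1 - x in
  exists F dF : R -> R, [/\ forall t, has_der F t (dF t),
    forall t, 0 <= t <= 1 ->
      dF t <= (expR (- (t * y)) * (1 + c * t ^+ 2 * y)) ^+ 2
    & gamma R <= a2 x * (F 1 - F 0)].
Proof.
move=> x01 y; have /andP[x0 x1] := x01.
(* The [p]s are the coefficients of the polynomial factor P of [dF], with constant term 1; the [q]s
   solve [2 Q - Q' = P] from the leading coefficient down. *)
pose p1 := 2 * x; pose p2 := 2 * x ^+ 2 + 2 * c * y; pose p3 := 4 * c * x * y.
pose p4 := 4 * c * x ^+ 2 * y + c ^+ 2 * y ^+ 2.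
pose p5 := 2 * x * c ^+ 2 * y ^+ 2; pose p6 := 2 * x ^+ 2 * c ^+ 2 * y ^+ 2.
pose q6 := p6 / 2; pose q5 := (p5 + 6 * q6) / 2; pose q4 := (p4 + 5 * q5) / 2.
pose q3 := (p3 + 4 * q4) / 2; pose q2 := (p2 + 3 * q3) / 2.
pose q1 := (p1 + 2 * q2) / 2; pose q0 := (1 + q1) / 2.
pose Q t := q0 + t * (q1 + t * (q2 + t * (q3 + t * (q4 + t * (q5 + t * q6))))).
pose F t := - (Q t * expR (- (2 * t))).
pose dF t := (1 + 2 * (t * x) + 2 * (t * x) ^+ 2) * (1 + c * t ^+ 2 * y) ^+ 2
  * expR (- (2 * t)).
have dFE t : has_der F t (dF t).
  apply: has_der_eq; first by rewrite /F /Q; der.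
  rewrite /dF /= /q0 /q1 /q2 /q3 /q4 /q5 /q6 /p1 /p2 /p3 /p4 /p5 /p6.
  by field.
exists F, dF; split=> //.
- move=> t /andP[t0 t1]; rewrite exprMn /dF.
  rewrite [leLHS]mulrAC ler_wpM2r ?sqr_ge0//.
  have -> : expR (- (t * y)) ^+ 2 = expR (2 * (t * x)) * expR (- (2 * t)).
    by rewrite expr2 -!expRD; congr expR; rewrite /y; ring.
  rewrite ler_wpM2r ?expR_ge0//.
  have h : 0 <= 2 * (t * x) by rewrite !mulr_ge0.
  have := expR_ge_cubic h; have := exprn_ge0 3 h; lra.
have M0 := M_gt0 x01; have MU := M_upper x01; have e0 := euler_gt0 R.
rewrite a2E mulrC ler_pdivlMr ?exprn_gt0//.
set m := 1 + _ + _ in MU.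
pose q : R := (e ^+ 2)^-1.
have gE : gamma R = 1 / 2 + q / 2 - 2 * q ^+ 2 - 21 * q ^+ 3.
  by rewrite /gamma /q; field; rewrite lt0r_neq0.
have [q1' q2'] : 135 / 10 ^+ 3 + 335 / 10 ^+ 6 <= q
    /\ q <= 135 / 10 ^+ 3 + 336 / 10 ^+ 6.
  have e1 := euler_ge R; have e2 := euler_le R; move: (e) e0 e1 e2 @q gE => k k0 k1 k2 q _.
  by rewrite /q -[(k ^+ 2)^-1]mul1r; split; [rewrite ler_pdivlMr|rewrite ler_pdivrMr];
    rewrite ?exprn_gt0//; nra.
have cE : c = 2 * q by [].
have E2 : expR (- (2 * 1)) = q.
  by rewrite mulr1 expRN /q -[2]/(1 + 1) expRD.
have g0 : 0 <= gamma R by rewrite gE; nra.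
apply: (@le_trans _ _ (gamma R * m ^+ 2)).
  by rewrite ler_wpM2l// lerXn2r ?nnegrE ?(ltW M0)// (le_trans (ltW M0) MU).
have -> : F 1 - F 0 = gamma R
    + (1 / 2 + q / 2 - 5 * q ^+ 2 - 67 * q ^+ 3) * x
    + (1 / 2 + q / 2 - 5 * q ^+ 2 - 134 * q ^+ 3) * x ^+ 2
    - (6 * q + 33 * q ^+ 2 - 553 * q ^+ 3) * x ^+ 3
    + (45 * q ^+ 2 - 331 * q ^+ 3) * x ^+ 4.
  rewrite /F E2 mulr0 oppr0 expR0 gE /Q /q0 /q1 /q2 /q3 /q4 /q5 /q6.
  rewrite /p1 /p2 /p3 /p4 /p5 /p6 cE /y; by field.
rewrite gE; apply: quartic_slack => //.
- by have := euler_ge R; clear; lra.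
- by have := euler_le R; clear; lra.
Qed.

Lemma B_ge0 x eta t : 0 <= x <= 1 -> 0 <= eta <= 1 -> 0 <= t <= 1 ->
  0 <= @B R (1 - x) eta t.
Proof.
move=> /andP[x0 x1] /andP[h0 h1] /andP[t0 t1]; have /andP[c1 _] := c_bounds R.
rewrite mulr_ge0 ?expR_ge0//.
have Dt : - (1 / 5) <= @D R t by rewrite /D; nra.
have : 0 <= c * t ^+ 2 * (1 - x).
  by apply: mulr_ge0; [apply: mulr_ge0; [lra|exact: sqr_ge0]|rewrite subr_ge0].
by move: (@D R t) Dt => d *; nra.
Qed.

(** The product of the two [B] is [(X Q)^2 + (eta + eta') W D + eta eta' (X D)^2]. The last term is
    a square. [W] decreases and [D] turns from positive to negative at 2/3, so freezing [W] at 2/3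
    can only lower the middle sum, and [sum_D_ge0] applies. *)
Lemma riemann_bound x eta eta' (N : nat) :
  0 <= x <= 1 -> 0 <= eta -> 0 <= eta' -> (0 < N)%N ->
  gamma R <= a2 x * (N%:R^-1 * \sum_(i < N)
    @B R (1 - x) eta (i%:R / N%:R) * @B R (1 - x) eta' (i%:R / N%:R)).
Proof.
move=> x01 h0 h0' N0; have /andP[x0 x1] := x01.
have /andP[c1 c2] := c_bounds R.
pose y := 1 - x; have [y0 y1] : 0 <= y /\ y <= 1 by rewrite /y; lra.
have N0R : 0 < N%:R :> R by rewrite ltr0n.
have [F [dF [dFE dFle gF]]] := main_integral x01.
pose X t : R := expR (- (t * y)); pose Q t : R := 1 + c * t ^+ 2 * y.
have c0 : 0 <= c by clear -c1; lra.
have Q0 t : 0 <= Q t.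
  by apply: addr_ge0 => //; apply: mulr_ge0 => //; exact: mulr_ge0 c0 (sqr_ge0 t).
have Xdec s t : s <= t -> X t <= X s.
  by move=> st; rewrite ler_expR lerN2 ler_wpM2r.
have XQdec s t : 0 <= s -> s <= t -> t <= 1 -> X t * Q t <= X s * Q s.
  move=> s0 st t1.
  have d (u : R) : has_der (fun u => - (expR (- (u * y)) * (1 + c * (u * u) * y))) u
      (expR (- (u * y)) * (y * (1 + c * (u * u) * y - 2 * c * u))).
    by apply: has_der_eq; [der|rewrite /=; ring].
  rewrite /X /Q -lerN2 !expr2; apply: (nondecreasing_der st d) => u /andP[su ut].
  rewrite mulr_ge0 ?expR_ge0// mulr_ge0//.
  have : 0 <= c * (u * u) * y.
    by apply: mulr_ge0 => //; apply: mulr_ge0 c0 _; rewrite -expr2 sqr_ge0.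
  by move: (c) c1 c2 => k *; nra.
pose W t := X t * (X t * Q t).
have Wdec s t : 0 <= s -> s <= t -> t <= 1 -> W t <= W s.
  move=> s0 st t1; apply: ler_pM; rewrite ?expR_ge0 ?mulr_ge0 ?expR_ge0//.
    exact: Xdec.
  exact: XQdec.
have W23 i : (i < N)%N ->
    W (2 / 3) * D (i%:R / N%:R) <= W (i%:R / N%:R) * D (i%:R / N%:R).
  move=> iN; set t := i%:R / N%:R.
  have t0 : 0 <= t by rewrite divr_ge0.
  have t1 : t <= 1 by rewrite ler_pdivrMr// mul1r ler_nat ltnW.
  rewrite -subr_ge0 -mulrBl /D.
  have [t23|t23] := lerP t (2 / 3).
    apply: mulr_ge0; first by rewrite subr_ge0; apply: Wdec => //; clear; lra.
    by apply: mulr_ge0; [clear; lra|apply: mulr_ge0 => //; clear -t23; lra].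
  rewrite -mulrNN; apply: mulr_ge0.
    rewrite opprB subr_ge0; apply: Wdec => //; [clear; lra|exact: ltW].
  rewrite -mulrN; apply: mulr_ge0; first by clear; lra.
  by rewrite -mulrN; apply: mulr_ge0 => //; clear -t23; lra.
have sumW : 0 <= \sum_(i < N) W (i%:R / N%:R) * D (i%:R / N%:R).
  apply: (@le_trans _ _ (\sum_(i < N) W (2 / 3) * D (i%:R / N%:R))).
    by rewrite -mulr_sumr mulr_ge0 ?sum_D_ge0// !mulr_ge0 ?expR_ge0.
  by apply: ler_sum => i _; exact: W23.
apply: le_trans gF _; rewrite ler_wpM2l ?(ltW (a2_gt0 x01))//.
pose L t := (X t * Q t) ^+ 2.
apply: le_trans (left_riemann_sum (L := L) N0 dFE dFle _) _.
  move=> s t s0 st t1; rewrite /L lerXn2r ?nnegrE ?mulr_ge0 ?expR_ge0//.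
  exact: XQdec.
rewrite ler_wpM2l ?invr_ge0 ?(ltW N0R)//.
apply: (@le_trans _ _ (\sum_(i < N) L (i%:R / N%:R)
    + (eta + eta') * \sum_(i < N) W (i%:R / N%:R) * D (i%:R / N%:R))).
  by rewrite lerDl mulr_ge0 ?addr_ge0.
rewrite mulr_sumr -big_split /=; apply: ler_sum => i _; set t := _ / _.
rewrite /B -/y -/(X t) -/(Q t) -subr_ge0.
rewrite [leRHS](_ : _ = (eta * eta') * (X t * D t) ^+ 2).
  by rewrite mulr_ge0 ?sqr_ge0 ?mulr_ge0.
by rewrite /L /W; ring.
Qed.

End Analysis4.

End Bounds.
Import Bounds.

(** * Uniform permutations compared with independent grid times *)

Module Arrival.

Section RandomOrder.
Variable E : finType.

Definition time_order (N : nat) (tau : E -> 'I_N) : rel E :=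
  fun a b => (tau a <= tau b)%N.

(** When [s] is applied to the enumeration of the edges, [a] lands at the position of [s^-1 a]. *)
Definition perm_order (s : {perm E}) : rel E :=
  fun a b => (enum_rank (s^-1 a)%g <= enum_rank (s^-1 b)%g)%N.

Lemma time_order_perm (N : nat) (tau : E -> 'I_N) : injective tau ->
  exists pi : {perm E}, time_order tau =2 perm_order pi.
Proof.
move=> tauI; pose rk a := #|[pred b | (tau b < tau a)%N]|.
have rk_lt a : (rk a < #|E|)%N.
  rewrite -cardsT; apply: proper_card.
  apply/properP; split; first by apply/subsetP => b; rewrite inE.
  by exists a; rewrite ?inE// ltnn.
have rk_homo a b : (tau a < tau b)%N -> (rk a < rk b)%N.
  move=> ab; apply: proper_card; apply/properP; split.
    by apply/subsetP => d; rewrite !inE => /ltn_trans; apply.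
  by exists a; rewrite !inE ?ltnn.
have rkE a b : (rk a <= rk b)%N = (tau a <= tau b)%N.
  have [ab|/rk_homo ba] := leqP (tau a) (tau b); last by rewrite leqNgt ba.
  move: ab; rewrite leq_eqVlt => /predU1P[/val_inj/tauI->|/rk_homo/ltnW //].
  by rewrite leqnn.
pose p a := enum_val (Ordinal (rk_lt a)).
have pI : injective p.
  move=> a b /enum_val_inj[/eqP]; rewrite eqn_leq !rkE -eqn_leq => /eqP.
  by move/val_inj/tauI.
exists (perm pI)^-1%g => a b.
by rewrite /perm_order invgK !permE /p !enum_valK /= rkE.
Qed.

Lemma card_collision (N : nat) (a b : E) : a != b ->
  (#|[pred tau : {ffun E -> 'I_N} | tau a == tau b]| * N <= N ^ #|E|)%N.
Proof.
move=> ab; pose S := [set tau : {ffun E -> 'I_N} | tau a == tau b].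
(* Overwriting the time of [a] loses nothing when it equals that of [b], so collisions times N
   values embed in all assignments. *)
pose upd (w : {ffun E -> 'I_N} * 'I_N) : {ffun E -> 'I_N} :=
  [ffun e => if e == a then w.2 else w.1 e].
have updI : {in setX S [set: 'I_N] &, injective upd}.
  move=> [s k] [t l]; rewrite !inE /= !andbT => /eqP sab /eqP tab /ffunP st.
  have kl : k = l by have := st a; rewrite !ffunE eqxx.
  congr pair => //; apply/ffunP => e; have := st e; rewrite !ffunE /=.
  case: eqVneq => [->|//] _; rewrite sab tab.
  by have := st b; rewrite !ffunE eq_sym (negbTE ab).
have := max_card (mem (upd @: setX S [set: 'I_N])).
by rewrite card_in_imset// cardsX cardsT card_ord card_ffun card_ord cardsE.
Qed.

Variable R : realType.

Lemma card_noninj (N : nat) : (0 < N)%N ->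
  #|[pred tau : {ffun E -> 'I_N} | ~~ injectiveb tau]|%:R / (N ^ #|E|)%:R
  <= (#|E| ^ 2)%:R / N%:R :> R.
Proof.
move=> N0; rewrite ler_pdivrMr ?ltr0n ?expn_gt0 ?N0// mulrAC.
rewrite ler_pdivlMr ?ltr0n// -!natrM ler_nat.
pose T := {ffun E -> 'I_N}.
pose C (w : E * E) := [set tau : T | (w.1 != w.2) && (tau w.1 == tau w.2)].
have sub : [set tau : T | ~~ injectiveb tau] \subset \bigcup_w C w.
  apply/subsetP => tau; rewrite inE => /injectivePn[a [b ab tab]].
  by apply/bigcupP; exists (a, b); rewrite ?inE//= ab tab eqxx.
have cE : #|[pred tau : T | ~~ injectiveb tau]|
    = #|[set tau : T | ~~ injectiveb tau]| by rewrite cardsE.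
rewrite cE; apply: (@leq_trans ((\sum_(w : E * E) #|C w|) * N)).
  rewrite leq_mul2r; apply/orP; right.
  apply: leq_trans (subset_leq_card sub) _.
  elim/big_ind2: _ => [|A m B n Am Bn|w _]; rewrite ?cards0//.
  by rewrite (leq_trans (leq_card_setU _ _))// leq_add.
rewrite big_distrl /=; apply: (@leq_trans (\sum_(w : E * E) N ^ #|E|)).
  apply: leq_sum => -[a b] _; have [->|ab] := eqVneq a b.
    by rewrite /C /= eqxx cardsE (eq_card0 (fun _ => _)).
  apply: leq_trans (card_collision N ab); rewrite leq_mul2r; apply/orP; right.
  by apply: subset_leq_card; apply/subsetP => tau; rewrite !inE => /andP[].
by rewrite sum_nat_const card_prod mulnn.
Qed.

(** Average over relabellings of the edges: for injective [tau], the orders of [act s tau] run once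
    through all [perm_order]. Assignments with a tie are charged the maximum [C], and a union bound
    over pairs makes them rare. *)
Lemma time_order_le_perm_order (N : nat) (Y : rel E -> nat) (C : nat) :
  (0 < N)%N -> (forall l l', l =2 l' -> Y l = Y l') -> (forall l, (Y l <= C)%N) ->
  (\sum_(tau : {ffun E -> 'I_N}) (Y (time_order tau))%:R) / (N ^ #|E|)%:R
  <= (\sum_(s : {perm E}) (Y (perm_order s))%:R) / #|{perm E}|%:R
     + C%:R * (#|E| ^ 2)%:R / N%:R :> R.
Proof.
move=> N0 Yext YC; pose T := {ffun E -> 'I_N}.
have M0 : 0 < (N ^ #|E|)%:R :> R by rewrite ltr0n expn_gt0 N0.
have P0 : 0 < #|{perm E}|%:R :> R by rewrite ltr0n; apply/card_gt0P; exists 1%g.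
pose act (s : {perm E}) (tau : T) : T := [ffun e => tau (s e)].
have actK s : cancel (act s) (act s^-1%g).
  by move=> tau; apply/ffunP => e; rewrite !ffunE permKV.
have sumE s : (\sum_(tau : T) Y (time_order tau) =
    \sum_(tau : T) Y (time_order (act s tau)))%N.
  by rewrite (reindex_inj (can_inj (actK s))).
have inj_sum (tau : T) : injective tau ->
    (\sum_s Y (time_order (act s tau)) = \sum_s Y (perm_order s))%N.
  move=> /time_order_perm[pi piE].
  pose h (s : {perm E}) := (pi * s^-1)%g.
  have hI : injective h by move=> s s' /mulgI /invg_inj.
  rewrite [RHS](reindex_inj hI) /=; apply: eq_bigr => s _; apply: Yext => a b.
  have := piE (s a) (s b); rewrite /time_order !ffunE => ->.
  by rewrite /perm_order /h invMg invgK !permM.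
have tot : (#|{perm E}| * (\sum_(tau : T) Y (time_order tau)) <=
    N ^ #|E| * (\sum_s Y (perm_order s)) +
    #|[pred tau : T | ~~ injectiveb tau]| * (#|{perm E}| * C))%N.
  have -> : (#|{perm E}| * (\sum_(tau : T) Y (time_order tau)) =
      \sum_(tau : T) \sum_s Y (time_order (act s tau)))%N.
    rewrite exchange_big /= -sum_nat_const; apply: eq_bigr => s _; exact: sumE.
  rewrite (bigID (fun tau : T => injectiveb tau)) /=; apply: leq_add.
    rewrite (eq_bigr (fun=> \sum_s Y (perm_order s))%N); last first.
      by move=> tau /injectiveP /inj_sum.
    by rewrite sum_nat_const leq_mul2r -[X in (_ <= X ^ _)%N](card_ord N)
      -card_ffun max_card orbT.
  rewrite -sum_nat_const; apply: leq_sum => tau _.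
  by rewrite -sum_nat_const; apply: leq_sum => s _; exact: YC.
rewrite -!natr_sum.
move: tot (card_noninj N0); set nI := #|[pred tau : T | ~~ injectiveb tau]|.
set A := (\sum_(tau : T) Y (time_order tau))%N.
set B := (\sum_s Y (perm_order s))%N.
rewrite -(ler_nat R) natrD !natrM => tot nIle.
apply: (@le_trans _ _ (B%:R / #|{perm E}|%:R + C%:R * (nI%:R / (N ^ #|E|)%:R))).
  move: (A%:R) (B%:R) (C%:R) (nI%:R) (#|{perm E}|%:R) ((N ^ #|E|)%:R) tot P0 M0.
  move=> a b c n p m tot P0 M0.
  rewrite ler_pdivrMr// -(ler_pM2l P0); apply: le_trans tot _.
  by rewrite le_eqVlt; apply/orP; left; apply/eqP; field; rewrite !lt0r_neq0.
by rewrite lerD2l -mulrA ler_wpM2l.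
Qed.

End RandomOrder.

End Arrival.
Import Arrival.

(** * The product measure and its cylinder events *)

Module Independence.

Section ProductMeasure.
Variables (R : realType) (E : finType) (x q : E -> R) (N : nat).
Hypothesis x01 : forall e, 0 <= x e <= 1.
Hypothesis q01 : forall e, 0 <= q e <= 1.
Hypothesis N0 : (0 < N)%N.
Local Notation times := {ffun E -> 'I_N}.
Local Notation p e := (x e * q e).

Definition bern (r : E -> R) (b : {ffun E -> bool}) : R :=
  \prod_e bernoulli_pmf (r e) (b e).

Definition expect (F : times -> pred E -> R) : R :=
  (\sum_(tau : times) \sum_act \sum_att
    bern x act * bern q att * F tau (fun e => act e && att e)) / (N ^ #|E|)%:R.

(** Law of a single edge: a uniform grid time, and an independent usable bit that is true with
    probability [p e]. *)
Definition mu (e : E) (P : nat -> bool -> bool) : R :=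
  (\sum_(k < N) (p e * (P k true)%:R + (1 - p e) * (P k false)%:R)) / N%:R.

Lemma mu_ext e P Q : (forall k b, P k b = Q k b) -> mu e P = mu e Q.
Proof. by move=> PQ; congr (_ / _); apply: eq_bigr => k _; rewrite !PQ. Qed.

Lemma bern_ge0 r b : (forall e, 0 <= r e <= 1) -> 0 <= bern r b.
Proof.
move=> r01; apply: prodr_ge0 => e _; have /andP[r0 r1] := r01 e.
by rewrite /bernoulli_pmf; case: ifP => _ //; rewrite subr_ge0.
Qed.

Lemma expect_le F F' : (forall tau al, F tau al <= F' tau al) ->
  expect F <= expect F'.
Proof.
move=> FF'; rewrite ler_wpM2r ?invr_ge0//.
apply: ler_sum => tau _; apply: ler_sum => a _; apply: ler_sum => b _.
by rewrite ler_wpM2l// mulr_ge0 ?bern_ge0.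
Qed.

Lemma expect_sum (I : finType) (P : pred I) (F : I -> times -> pred E -> R) :
  expect (fun tau al => \sum_(i | P i) F i tau al) = \sum_(i | P i) expect (F i).
Proof.
rewrite /expect -mulr_suml; congr (_ / _).
rewrite [RHS]exchange_big; apply: eq_bigr => tau _.
rewrite [RHS]exchange_big; apply: eq_bigr => a _.
by rewrite [RHS]exchange_big; apply: eq_bigr => b _; rewrite -mulr_sumr.
Qed.

Lemma natr_forall (P : pred E) : ([forall e, P e])%:R = \prod_e (P e)%:R :> R.
Proof.
have [/forallP H|/forallPn[e Pe]] := boolP [forall e, P e].
  by rewrite big1// => e _; rewrite H.
by rewrite (bigD1 e)//= (negbTE Pe) mul0r.
Qed.

(** Independence of the edges, in the form of distributivity of a product over sums. *)
Lemma expect_rect (P : E -> nat -> bool -> bool) :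
  expect (fun tau al => [forall e, P e (tau e) (al e)]%:R) = \prod_e mu e (P e).
Proof.
have muE e : mu e (P e) = \sum_(k < N) \sum_a \sum_b bernoulli_pmf (x e) a *
    bernoulli_pmf (q e) b * (P e k (a && b))%:R / N%:R.
  rewrite /mu mulr_suml; apply: eq_bigr => k _.
  by rewrite !big_bool /= -!mulrDl; congr (_ / _); ring.
rewrite (eq_bigr _ (fun e _ => muE e)) bigA_distr_bigA /= /expect mulr_suml.
apply: eq_bigr => tau _; rewrite bigA_distr_bigA /= mulr_suml.
apply: eq_bigr => a _; rewrite bigA_distr_bigA /= mulr_suml.
apply: eq_bigr => b _; rewrite natr_forall !big_split /=; congr (_ * _).
by rewrite prodr_const natrX exprVn.
Qed.

Lemma card_sum (P : pred nat) :
  #|[pred k : 'I_N | P k]| = (\sum_(k < N) P k)%N.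
Proof.
by rewrite -sum1_card big_mkcond; apply: eq_bigr => k _; rewrite inE; case: (P k).
Qed.

Lemma card_ltn (m : nat) : (m <= N)%N -> #|[pred k : 'I_N | (k < m)%N]| = m.
Proof.
by move=> mN; rewrite -sum1_card (big_ord_narrow mN) /= sum1_card card_ord.
Qed.

Lemma mu_special e (P : pred nat) :
  mu e (fun k b => b && P k) = p e * (#|[pred k : 'I_N | P k]|%:R / N%:R).
Proof.
rewrite /mu mulrA; congr (_ / _).
rewrite (eq_bigr (fun k : 'I_N => p e * (P k)%:R)); last first.
  by move=> k _ /=; rewrite mulr0 addr0.
by rewrite -mulr_sumr -natr_sum card_sum.
Qed.

Lemma mu_late e (m : nat) : (m <= N)%N ->
  mu e (fun k b => ~~ (b && (k < m)%N)) = 1 - p e * (m%:R / N%:R).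
Proof.
move=> mN; rewrite /mu.
rewrite (eq_bigr (fun k : 'I_N => 1 - p e * (k < m)%N%:R)); last first.
  by move=> k _ /=; case: (k < m)%N => /=; ring.
rewrite sumrB sumr_const card_ord -mulr_sumr -natr_sum.
have -> : (\sum_(i < N) (i < m)%N)%N = m.
  by rewrite -[RHS](card_ltn mN) (card_sum (fun k => (k < m)%N)).
rewrite mulrBl divff ?pnatr_eq0 -?lt0n// mulrA; by [].
Qed.

Lemma forall_all (T : Type) (Q : E -> T -> bool) (s : seq T) :
  [forall e, all (Q e) s] = all (fun c => [forall e, Q e c]) s.
Proof.
elim: s => [|c s IH] /=; first by apply/forallP.
rewrite -IH; apply/forallP/andP => [H|[/forallP h1 /forallP h2] e].
  by split; apply/forallP => e; have /andP[] := H e.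
by rewrite h1 h2.
Qed.

Definition keys (sp : seq (E * pred nat)) := map fst sp.

(** A cylinder event. The edges named in [sp] are exempt from the lateness conditions [cs], so each
    edge is governed by one list only; compatibility among named edges is checked when a certificate
    is built. *)
Definition rect (sp : seq (E * pred nat)) (cs : seq (pred E * nat))
    (tau : times) (al : pred E) : bool :=
  all (fun s : E * pred nat => al s.1 && s.2 (tau s.1)) sp &&
  all (fun c : pred E * nat => [forall e, (e \notin keys sp) && c.1 e ==>
                  ~~ (al e && (tau e < c.2)%N)]) cs.

Lemma prod_swap (T : Type) (Q : T -> E -> bool) (F : T -> E -> R) (s : seq T) :
  \prod_(c <- s) \prod_(e | Q c e) F c e = \prod_e \prod_(c <- s | Q c e) F c e.
Proof.
elim: s => [|c s IH].
  by rewrite big_nil big1// => e _; rewrite big_nil.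
rewrite big_cons IH big_mkcond -big_split; apply: eq_bigr => e _ /=.
by rewrite big_cons; case: ifP => _; rewrite ?mul1r.
Qed.

Lemma mu_keys (sp : seq (E * pred nat)) e : uniq (keys sp) -> e \in keys sp ->
  mu e (fun k b => all (fun s : E * pred nat => (s.1 == e) ==> b && s.2 k) sp) =
  \prod_(s <- sp | s.1 == e) (p s.1 * (#|[pred k : 'I_N | s.2 k]|%:R / N%:R)).
Proof.
elim: sp => //= -[e' P] sp IH /andP[e'sp spU]; rewrite inE big_cons /= eq_sym.
case: (eqVneq e' e) => [<-|ee'] /=; last exact: IH.
move=> _.
have tr b k : all (fun s : E * pred nat => (s.1 == e') ==> b && s.2 k) sp.
  move: e'sp {spU IH}; elim: sp => //= s sp IH; rewrite inE negb_or => /andP[h1 h2].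
  by rewrite eq_sym (negbTE h1) IH.
have -> : \prod_(s <- sp | s.1 == e')
    (p s.1 * (#|[pred k : 'I_N | s.2 k]|%:R / N%:R)) = 1.
  move: e'sp {spU IH tr}; elim: sp => [|s sp IH /=]; first by rewrite big_nil.
  rewrite inE negb_or => /andP[h1 h2].
  by rewrite big_cons eq_sym (negbTE h1) IH.
by rewrite mulr1 -mu_special; apply: mu_ext => k b; rewrite tr andbT.
Qed.

Lemma p01 e : 0 <= p e <= 1.
Proof.
have /andP[a b] := x01 e; have /andP[c d] := q01 e.
by rewrite mulr_ge0//= mulr_ile1.
Qed.

Lemma late_factor e m : (m <= N)%N -> 0 <= 1 - p e * (m%:R / N%:R) <= 1.
Proof.
move=> mN; have /andP[p0 p1] := p01 e.
have m0 : 0 <= m%:R / N%:R :> R by rewrite divr_ge0.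
have m1 : m%:R / N%:R <= 1 :> R by rewrite ler_pdivrMr ?ltr0n// mul1r ler_nat.
by rewrite subr_ge0 mulr_ile1//= lerBlDr lerDl mulr_ge0.
Qed.

Lemma prod_late_factor e (P : pred (pred E * nat)) (cs : seq (pred E * nat)) :
  (forall c, List.In c cs -> (c.2 <= N)%N) ->
  0 <= \prod_(c <- cs | P c) (1 - p e * (c.2%:R / N%:R)) <= 1.
Proof.
elim: cs => [|c cs IH] csN; first by rewrite big_nil ler01 lexx.
have {}IH : 0 <= \prod_(c <- cs | P c) (1 - p e * (c.2%:R / N%:R)) <= 1.
  by apply: IH => c' h; apply: csN; right.
rewrite big_cons; case: ifP => // _.
have /andP[c0 c1] := late_factor e (csN c (or_introl erefl)).
by have /andP[s0 s1] := IH; rewrite mulr_ge0//= mulr_ile1.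
Qed.

(** All lateness conditions on [e] reduce to the one with the largest threshold [th], whose factor
    alone is at least the product of all factors, each being at most 1. *)
Lemma mu_nonkeys (cs : seq (pred E * nat)) e :
  (forall c, List.In c cs -> (c.2 <= N)%N) ->
  \prod_(c <- cs | c.1 e) (1 - p e * (c.2%:R / N%:R)) <=
  mu e (fun k b => all (fun c : pred E * nat => c.1 e ==> ~~ (b && (k < c.2)%N)) cs).
Proof.
move=> csN; pose th := (\max_(c <- cs | c.1 e) c.2)%N.
have thN : (th <= N)%N.
  rewrite /th {th}; elim: cs csN => [|c cs IH] csN; first by rewrite big_nil.
  have cN : (c.2 <= N)%N by apply: csN; left.
  have := IH (fun c' h => csN c' (or_intror h)).
  by rewrite big_cons; case: ifP => // _ ?; rewrite geq_max cN.
have -> : mu e (fun k b =>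
      all (fun c : pred E * nat => c.1 e ==> ~~ (b && (k < c.2)%N)) cs) =
    mu e (fun k b => ~~ (b && (k < th)%N)).
  have eqP k b : all (fun c : pred E * nat => c.1 e ==> ~~ (b && (k < c.2)%N)) cs =
      ~~ (b && (k < th)%N).
    rewrite /th; case: b => /=; last by elim: (cs) => //= c s ->; rewrite implybT.
    elim: (cs) => [|c s IH]; first by rewrite big_nil ltn0.
    rewrite big_cons /= IH; case: ifP => _ //=.
    by rewrite -!leqNgt geq_max.
  by apply: mu_ext => k b; exact: eqP.
rewrite mu_late// /th.
clear th thN; elim: cs csN => [|c cs IH] csN.
  by rewrite !big_nil mul0r mulr0 subr0.
have cN : (c.2 <= N)%N by apply: csN; left.
have csN' c' : List.In c' cs -> (c'.2 <= N)%N by move=> h; apply: csN; right.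
have {}IH := IH csN'.
rewrite !big_cons; case: ifP => // _.
have /andP[c0 c1] := late_factor e cN.
have /andP[P0 P1] := prod_late_factor e (fun c => c.1 e) csN'.
have [cth|thc] := leqP c.2 (\max_(j <- cs | j.1 e) j.2).
  by apply: le_trans IH; rewrite ler_piMl.
by rewrite -[leRHS]mulr1 ler_wpM2l.
Qed.

(** An inequality because the left side charges an edge once for every condition on it; this is
    where overlapping neighbourhoods turn out favourable. *)
Lemma rect_bound (sp : seq (E * pred nat)) (cs : seq (pred E * nat)) :
  uniq (keys sp) -> (forall c, List.In c cs -> (c.2 <= N)%N) ->
  (\prod_(s <- sp) (p s.1 * (#|[pred k : 'I_N | s.2 k]|%:R / N%:R))) *
  (\prod_(c <- cs) \prod_(e | (e \notin keys sp) && c.1 e)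
     (1 - p e * (c.2%:R / N%:R)))
  <= expect (fun tau al => (rect sp cs tau al)%:R).
Proof.
move=> spU csN.
(* The same event with its conditions regrouped edge by edge. *)
pose P e (k : nat) b :=
  all (fun s : E * pred nat => (s.1 == e) ==> b && s.2 k) sp &&
  ((e \notin keys sp) ==>
   all (fun c : pred E * nat => c.1 e ==> ~~ (b && (k < c.2)%N)) cs).
have -> : expect (fun tau al => (rect sp cs tau al)%:R) =
    expect (fun tau al => [forall e, P e (tau e) (al e)]%:R).
  congr (_ / _); apply: eq_bigr => tau _; apply: eq_bigr => a _.
  apply: eq_bigr => b _; congr (_ * _%:R); congr nat_of_bool.
  set al := fun e => a e && b e; rewrite /rect.
  have -> : all (fun s : E * pred nat => al s.1 && s.2 (tau s.1)) sp =
      [forall e, all (fun s : E * pred nat =>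
        (s.1 == e) ==> al e && s.2 (tau e)) sp].
    rewrite forall_all; apply: eq_all => s.
    apply/idP/forallP => [H e|/(_ s.1)]; last by rewrite eqxx.
    by apply/implyP => /eqP <-.
  rewrite -forall_all; apply/andP/forallP => [[/forallP h1 /forallP h2] e|H].
    rewrite /P h1 /=; apply/implyP => eK; move: (h2 e).
    by rewrite eK.
  split; apply/forallP => e; have /andP[h1 /implyP h2] := H e; first exact: h1.
  by case: (boolP (e \in keys sp)) h2 => [_ _|_ /(_ isT) //]; elim: (cs).
rewrite expect_rect.
rewrite (prod_swap (fun c e => (e \notin keys sp) && c.1 e)).
have -> : \prod_(s <- sp) (p s.1 * (#|[pred k : 'I_N | s.2 k]|%:R / N%:R)) =
    \prod_(s <- sp) \prod_(e | s.1 == e)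
      (p s.1 * (#|[pred k : 'I_N | s.2 k]|%:R / N%:R)).
  by apply: eq_bigr => s _; rewrite (big_pred1 s.1).
rewrite (prod_swap (fun s e => s.1 == e)).
rewrite -big_split /=.
apply: ler_prod => e _; apply/andP; split.
  apply: mulr_ge0.
    apply: prodr_ge0 => c _.
    by have /andP[? _] := p01 c.1; rewrite mulr_ge0// divr_ge0.
  by have /andP[] := prod_late_factor e (fun c => (e \notin keys sp) && c.1 e) csN.
have [eK|eK] := boolP (e \in keys sp).
  rewrite [\prod_(c <- cs | _) _]big_pred0_eq mulr1 -(mu_keys spU eK).
  rewrite le_eqVlt; apply/orP; left; apply/eqP; apply: mu_ext => k b.
  by rewrite /P eK andbT.
rewrite (_ : \prod_(s <- sp | s.1 == e) _ = 1); last first.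
  elim: (sp) eK => [|s s' IH]; first by rewrite big_nil.
  rewrite inE negb_or => /andP[h1 h2].
  by rewrite big_cons eq_sym (negbTE h1) IH.
rewrite mul1r; apply: le_trans (mu_nonkeys e csN) _.
rewrite le_eqVlt; apply/orP; left; apply/eqP; apply: mu_ext => k b.
rewrite /P eK /= [X in X && _](_ : _ = true)//.
elim: (sp) eK => //= s s' IH; rewrite inE negb_or => /andP[h1 h2].
by rewrite eq_sym (negbTE h1) IH.
Qed.

End ProductMeasure.

End Independence.
Import Independence.

(** * The greedy run and certificates for a free end *)

Module Matching.

Section Graph.
Variable G : sgraph.
Local Notation E := (edge G).
Implicit Types (e f g h : E) (u v w z : G).

Definition meets e e' : bool := ~~ [disjoint ends e & ends e'].

Lemma common_endP e e' : reflect (exists2 z, z \in ends e & z \in ends e') (meets e e').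
Proof.
rewrite /meets -setI_eq0; apply: (iffP (set0Pn _)) => [[z]|[z ze ze']].
  by rewrite inE => /andP[]; exists z.
by exists z; rewrite inE ze.
Qed.

Lemma meetsC e e' : meets e e' = meets e' e.
Proof. by rewrite /meets disjoint_sym. Qed.

Lemma ends_pair e u w : u \in ends e -> w \in ends e -> u != w ->
  ends e = [set u; w].
Proof.
move=> ue we uw; apply/esym/eqP; rewrite eqEcard cards2 uw (edges_card2 (svalP e)).
by rewrite andbT; apply/subsetP => z; rewrite !inE => /orP[] /eqP->.
Qed.

Lemma other_end e u : u \in ends e -> exists2 w, u != w & ends e = [set u; w].
Proof.
move=> ue; have : #|ends e :\ u| = 1%N.
  by have := edges_card2 (svalP e); rewrite (cardsD1 u) -/(ends e) ue => -[].
move=> /eqP/cards1P[w ew]; have : w \in ends e :\ u by rewrite ew inE.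
by rewrite !inE => /andP[wu we]; exists w; rewrite 1?eq_sym// (ends_pair ue we)// eq_sym.
Qed.

Lemma ends_inj e e' : ends e = ends e' -> e = e'.
Proof. exact: val_inj. Qed.

Lemma edge_eq e e' u w : u != w -> u \in ends e -> w \in ends e ->
  u \in ends e' -> w \in ends e' -> e = e'.
Proof.
by move=> uw *; apply: ends_inj; rewrite (@ends_pair e u w)// (@ends_pair e' u w).
Qed.

Lemma edge_adj e u w : u != w -> u \in ends e -> w \in ends e -> adj u w.
Proof. by move=> uw ue we; rewrite /adj -(ends_pair ue we uw); exact: (svalP e). Qed.

Lemma adj_sym u w : adj u w = adj w u.
Proof. by rewrite /adj setUC. Qed.

Lemma adj_neq u w : adj u w -> u != w.
Proof.
move=> uw; apply/eqP => e; have := edges_card2 (uw : [set u; w] \in edges G).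
by rewrite e setUid cards1.
Qed.

Lemma no_triangle u v w : ~ has_cycle_of_length G 3 ->
  adj u v -> adj v w -> adj w u -> False.
Proof.
move=> no3 uv vw wu; apply: no3; exists [:: u; v; w] => //.
rewrite /ucycle /= uv vw wu /= !inE negb_or (adj_neq uv) (adj_neq vw).
by rewrite eq_sym (adj_neq wu).
Qed.

Lemma no_pentagon (a b c d e : G) : ~ has_cycle_of_length G 5 ->
  uniq [:: a; b; c; d; e] ->
  adj a b -> adj b c -> adj c d -> adj d e -> adj e a -> False.
Proof.
move=> no5 U ab bc cd de ea; apply: no5; exists [:: a; b; c; d; e] => //.
by apply/andP; split=> //=; rewrite ab bc cd de ea.
Qed.

Section Greedy.
Variable w : outcome G.
Local Notation alive e := (active w e && attenuation_bit w e).
Local Notation run s := (foldl (rom_step w) set0 s).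

Lemma run_mem s e : e \in run s -> e \in s /\ alive e.
Proof.
elim/last_ind: s e => [|s f IH] e; first by rewrite inE.
rewrite foldl_rcons /rom_step mem_rcons inE.
case: ifP => [/and3P[a b _]|_ /IH[-> ->]]; last by rewrite orbT.
by rewrite !inE => /predU1P[->|/IH[-> ->]]; rewrite ?eqxx ?a ?b// orbT.
Qed.

Lemma run_mono s s' e : e \in run s -> e \in run (s ++ s').
Proof.
elim/last_ind: s' => [|s' f IH]; first by rewrite cats0.
move=> /IH es; rewrite -rcons_cat foldl_rcons /rom_step.
by case: ifP => //; rewrite inE es orbT.
Qed.

Lemma run_select s f s' : alive f -> (forall e, e \in run s -> ~~ meets e f) ->
  f \in run (s ++ f :: s').
Proof.
move=> /andP[a b] free; rewrite -cat_rcons; apply: run_mono.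
rewrite foldl_rcons /rom_step a b /=; case: ifPn => [_|]; first by rewrite !inE eqxx.
move=> /forallPn[v]; rewrite negb_imply negbK => /andP[vf /existsP[e /andP[eM ve]]].
by have /negP[] := free e eM; apply/common_endP; exists v.
Qed.

Lemma run_reject s g s' h : g \notin s -> g \notin s' -> h \in run s ->
  meets h g -> g \notin run (s ++ g :: s').
Proof.
move=> gs gs' hs hg; elim/last_ind: s' gs' => [|s' e IH].
  move=> _; rewrite cats1 foldl_rcons /rom_step ifF.
    by apply: contra gs => /run_mem[].
  apply/negP => /and3P[_ _ /forallP free].
  have /common_endP[z zh zg] := hg; have := free z; rewrite zg /= => /existsPn/(_ h).
  by rewrite hs zh.
rewrite mem_rcons inE negb_or => /andP[ge gs'].
rewrite -rcons_cons -rcons_cat foldl_rcons /rom_step; case: ifP => _; last exact: IH.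
by rewrite !inE negb_or ge IH.
Qed.

Local Notation rk e := (index e (arrivals w)).

Lemma arrivals_uniq : uniq (arrivals w).
Proof. by rewrite map_inj_uniq ?enum_uniq//; exact: perm_inj. Qed.

Lemma arrivals_mem e : e \in arrivals w.
Proof. by apply/mapP; exists ((w.1.1)^-1%g e); rewrite ?mem_enum// permKV. Qed.

Lemma before_mem s s' e f : arrivals w = s ++ f :: s' ->
  (e \in s) = (rk e < rk f)%N.
Proof.
move=> sE; have := arrivals_uniq; rewrite sE cat_uniq /= negb_or => /and3P[_ /andP[fs _] _].
rewrite !index_cat (negbTE fs) /= eqxx addn0.
by case: ifP => es; [rewrite index_mem es|rewrite ltnNge leq_addr].
Qed.

(** Nothing usable near [h] precedes it, so [h] is selected and [e] is rejected; hence no selected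
    edge meets [f] on its arrival. *)
Lemma greedy_free f : alive f ->
  (forall e, meets e f -> alive e -> (rk e < rk f)%N ->
     exists h, [/\ meets h e, alive h, (rk h < rk e)%N &
       forall e', meets e' h -> alive e' -> (rk h <= rk e')%N]) ->
  f \in attenuate_rom w.
Proof.
move=> af H; rewrite /attenuate_rom.
have [s1 [s2 sE]] : exists s1 s2, arrivals w = s1 ++ f :: s2.
  by case/splitPr: (arrivals_mem f) => s1 s2; exists s1, s2.
rewrite sE; apply: run_select => // e eM; apply/negP => ef.
have [es1 ae] := run_mem eM.
have ltef : (rk e < rk f)%N by rewrite -(before_mem e sE).
have [h [he ah lthe iso]] := H e ef ae ltef.
have U := arrivals_uniq.
have s1E : exists s3 s4, s1 = s3 ++ e :: s4.
  by case/splitPr: es1 => s3 s4; exists s3, s4.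
have [s3 [s4 s1E']] := s1E.
have sE2 : arrivals w = s3 ++ e :: (s4 ++ f :: s2) by rewrite sE s1E' -catA.
have hs3 : h \in s3 by rewrite (before_mem h sE2).
have [s5 [s6 s3E]] : exists s5 s6, s3 = s5 ++ h :: s6.
  by case/splitPr: hs3 => s5 s6; exists s5, s6.
have sE3 : arrivals w = s5 ++ h :: (s6 ++ e :: (s4 ++ f :: s2)).
  by rewrite sE2 s3E -catA.
have hM : h \in run s3.
  rewrite s3E; apply: run_select => // e' e'M; apply/negP => e'h.
  have [e's5 ae'] := run_mem e'M.
  by have := iso _ e'h ae'; rewrite leqNgt -(before_mem e' sE3) e's5.
move: eM; rewrite s1E'; apply/negP; apply: run_reject hM he.
  by rewrite (before_mem e sE2) ltnn.
move: U; rewrite sE2 cat_uniq => /and3P[_ _ /= /andP[eN _]].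
by move: eN; rewrite mem_cat negb_or => /andP[].
Qed.

End Greedy.

(** The blocker avoids [u]: otherwise it would be a second earlier edge there. It therefore meets
    [gh.1] at its far end. *)
Definition valid u f (gh : E * E) : bool :=
  [&& u \in ends gh.1, gh.1 != f, u \notin ends gh.2 & meets gh.1 gh.2].

Section Side.
Variables (le : rel E) (al : pred E).

(* [u] is free when [f] arrives because either no other active edge at [u] has
   arrived, or a single one [gh.1] has and it was blocked by [gh.2], itself
   isolated on arrival. *)
Definition side f u (A : option (E * E)) : bool :=
  match A with
  | None => [forall e, (u \in ends e) && (e != f) ==> ~~ (al e && ~~ le f e)]
  | Some gh => [&& valid u f gh, al gh.1, al gh.2, le gh.2 gh.1, le gh.1 f,
      [forall e, [&& u \in ends e, e != f & e != gh.1] ==> ~~ (al e && ~~ le f e)]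
    & [forall e, [&& meets e gh.2, e != gh.2 & e != gh.1] ==>
         ~~ (al e && ~~ le gh.2 e)]]
  end.

(** A count rather than a truth value, so that its expectation is a sum over pairs of
    certificates. *)
Definition witnesses f u v : nat :=
  (al f * (\sum_A side f u A) * (\sum_B side f v B))%N.

Variable r : E -> nat.
Hypothesis r_inj : injective r.
Hypothesis leE : forall a b, le a b = (r a <= r b)%N.

Lemma le_lt a b : a != b -> le a b -> (r a < r b)%N.
Proof.
move=> ab; rewrite leE leq_eqVlt => /predU1P[/r_inj e|//].
by rewrite e eqxx in ab.
Qed.

(** Two different first components would both be earlier usable edges at [u]. Two blockers of the
    same [g] meet at its far end, and each isolated one would have to precede the other. *)
Lemma side_inj f u A B : side f u A -> side f u B -> A = B.
Proof.
have noneF gh : side f u None -> side f u (Some gh) -> False.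
  move=> /forallP/(_ gh.1) h /and5P[/and4P[ug gf _ _] ag _ _ /andP[gf' _]].
  by move: h; rewrite ug gf ag leE -ltnNge (le_lt gf gf').
case: A B => [[g h]|] [[g' h']|] sA sB //; try by [case: (noneF _ sB sA)|case: (noneF _ sA sB)].
case/and5P: sA => /and4P[/= ug gf uh gh] ag ah hg /and3P[gf' /forallP F1 /forallP F2].
case/and5P: sB => /and4P[/= ug' gpf uh' gh'] ag' ah' hg' /and3P[gpf' /forallP F1' /forallP F2'].
have [ggE|gg] := eqVneq g g'; last first.
  by have := F1 g'; rewrite ug' gpf eq_sym gg ag' leE -ltnNge (le_lt gpf gpf').
rewrite -{}ggE in ug' gpf gh' ag' hg' gpf' F1' F2' *.
have [-> //|hh] := eqVneq h h'.
have hg0 : h != g by apply: contraNneq uh => ->.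
have hg1 : h' != g by apply: contraNneq uh' => ->.
have mhh : meets h h'.
  have [w uw gE] := other_end ug.
  have wh k : u \notin ends k -> meets g k -> w \in ends k.
    move=> uk /common_endP[z]; rewrite gE !inE => /orP[]/eqP-> // zk.
    by rewrite zk in uk.
  by apply/common_endP; exists w; apply: wh.
have l1 : (r h' <= r h)%N by have /= := F2' h; rewrite mhh hh hg0 ah leE /= negbK.
have l2 : (r h <= r h')%N.
  by have /= := F2 h'; rewrite meetsC mhh (eq_sym h') hh hg1 ah' leE /= negbK.
by exfalso; move/eqP: hh; apply; apply: r_inj; apply/eqP; rewrite eqn_leq l1 l2.
Qed.

Lemma sum_side_le1 f u : (\sum_A side f u A <= 1)%N.
Proof.
have [/existsP[A sA]|/existsPn no] := boolP [exists A, side f u A].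
  rewrite (bigD1 A)//= big1 ?addn0 ?leq_b1// => B BA.
  by case: (boolP (side f u B)) => // sB; rewrite (side_inj sA sB) eqxx in BA.
by rewrite big1// => A _; rewrite (negbTE (no A)).
Qed.

Lemma witnessesP f u v : (0 < witnesses f u v)%N ->
  [/\ al f, exists A, side f u A & exists B, side f v B].
Proof.
rewrite /witnesses !muln_gt0 lt0b => /andP[/andP[af hu] hv].
have ex z : (0 < \sum_A side f z A)%N -> exists A, side f z A.
  rewrite lt0n => /eqP s; apply/existsP; apply: contraT => /existsPn no.
  by case: s; rewrite big1// => A _; rewrite (negbTE (no A)).
by split=> //; apply: ex.
Qed.

Lemma witnesses_le1 f u v : (witnesses f u v <= 1)%N.
Proof.
by rewrite /witnesses -[1%N]/(1 * 1 * 1)%N !leq_mul ?leq_b1 ?sum_side_le1.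
Qed.

Lemma side_blocked f u A e : side f u A -> u \in ends e -> e != f -> al e ->
  (r e < r f)%N -> exists h, [/\ meets h e, al h, (r h < r e)%N &
       forall e', meets e' h -> al e' -> (r h <= r e')%N].
Proof.
case: A => [[g h]|]; last first.
  by move=> /forallP/(_ e) H ue ef ae ltef; move: H; rewrite ue ef ae leE -ltnNge ltef.
case/and5P=> /and4P[/= ug gf uh gh] ag ah hg /and3P[gf' /forallP F1 /forallP F2].
move=> ue ef ae ltef; have [eg|eg] := eqVneq e g; last first.
  by have := F1 e; rewrite ue ef eg ae leE -ltnNge ltef.
have hg0 : h != g by apply: contraNneq uh => ->.
have lthg := le_lt hg0 hg.
exists h; rewrite eg meetsC; split=> // e' e'h ae'.
have [->//|e'h'] := eqVneq e' h; have [->|e'g] := eqVneq e' g; first exact: ltnW.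
by have := F2 e'; rewrite e'h e'h' e'g ae' /= negbK leE.
Qed.

End Side.

Lemma side_ext le le' al f u A : le =2 le' -> side le al f u A = side le' al f u A.
Proof.
move=> E0; case: A => [[g h]|] /=.
  by rewrite !E0; do !congr (_ && _); apply: eq_forallb => e; rewrite !E0.
by apply: eq_forallb => e; rewrite !E0.
Qed.

Lemma witnesses_ext le le' al f u v : le =2 le' ->
  witnesses le al f u v = witnesses le' al f u v.
Proof.
move=> E0; rewrite /witnesses; congr (_ * _ * _)%N; apply: eq_bigr => A _;
  by rewrite (side_ext _ _ _ _ E0).
Qed.

Lemma witnesses_selected (w : outcome G) f u v : ends f = [set u; v] ->
  (witnesses (perm_order w.1.1) (fun e => active w e && attenuation_bit w e) f u v
   <= (f \in attenuate_rom w))%N.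
Proof.
move=> fE; set al := fun e => _.
pose r e := index e (arrivals w).
have rI : injective r.
  by move=> a b ab; rewrite -(nth_index a (arrivals_mem w a)) -/(r a) ab nth_index// arrivals_mem.
have leE a b : perm_order w.1.1 a b = (r a <= r b)%N.
  have rkE e : r e = enum_rank ((w.1.1)^-1%g e) :> nat.
    rewrite /r -{1}(permKV w.1.1 e) index_map; last exact: perm_inj.
    rewrite -[X in index X _](nth_enum_rank ((w.1.1)^-1%g e)) index_uniq ?enum_uniq//.
    by rewrite -cardE.
  by rewrite /perm_order !rkE.
have [->//|] := posnP (witnesses (perm_order w.1.1) al f u v).
move=> /witnessesP[af [A sA] [B sB]].
rewrite (_ : f \in _ = true) ?(witnesses_le1 _ rI leE)//.
apply: greedy_free => // e /common_endP[z ze zf] ae ltef.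
have ef : e != f by apply: contraTneq ltef => ->; rewrite ltnn.
move: zf; rewrite fE !inE => /orP[]/eqP zE; rewrite {}zE in ze.
  exact: (side_blocked rI leE sA).
exact: (side_blocked rI leE sB).
Qed.

(** Crude bound valid for any relation; grid times with ties do not give the uniqueness behind
    [witnesses_le1]. *)
Lemma witnesses_le_card le al f u v :
  (witnesses le al f u v <= #|{: option (E * E)}| ^ 2)%N.
Proof.
have h z : (\sum_A side le al f z A <= #|{: option (E * E)}|)%N.
  by rewrite -sum1_card leq_sum// => A _; exact: leq_b1.
by rewrite /witnesses -mulnA -[X in (_ <= X)%N]mul1n !leq_mul ?leq_b1.
Qed.

End Graph.

End Matching.
Import Matching.

(** * From the selection probability to cylinders of certificates *)

Module Patterns.

Section Reduction.
Variables (R : realType) (G : sgraph) (x : edge G -> R) (a : R -> R).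
Hypothesis x01 : forall e, 0 <= x e <= 1.
Hypothesis a01 : forall e, 0 <= a (x e) <= 1.
Local Notation E := (edge G).
Local Notation q := (fun e => a (x e)).

(** For fixed activity and attenuation bits only the law of the order changes. [K] is chosen before
    [N], so the error can be made arbitrarily small. *)
Lemma selection_ge_expect f u v : ends f = [set u; v] ->
  exists K : R, forall N, (0 < N)%N ->
    expect x q (N := N) (fun tau al => (witnesses (time_order tau) al f u v)%:R)
    <= selection_prob x a f + K / N%:R.
Proof.
move=> fE; pose C := (#|{: option (E * E)}| ^ 2)%N.
pose al (b b' : {ffun E -> bool}) : pred E := fun e => b e && b' e.
pose Y b b' l := witnesses l (al b b') f u v.
pose wt b b' := bern x b * bern q b'.
have wt0 b b' : 0 <= wt b b' by rewrite mulr_ge0 ?bern_ge0.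
pose Kc : R := C%:R * (#|E| ^ 2)%:R.
exists ((\sum_b \sum_b' wt b b') * Kc) => N N0.
have step b b' : (\sum_(tau : {ffun E -> 'I_N}) (Y b b' (time_order tau))%:R)
      / (N ^ #|E|)%:R
    <= (\sum_(s : {perm E}) (Y b b' (perm_order s))%:R) / #|{perm E}|%:R
       + Kc / N%:R.
  apply: time_order_le_perm_order => // [l l' ll|l].
    exact: witnesses_ext.
  exact: witnesses_le_card.
have -> : expect x q (N := N) (fun tau al => (witnesses (time_order tau) al f u v)%:R)
    = \sum_b \sum_b' wt b b' *
      ((\sum_(tau : {ffun E -> 'I_N}) (Y b b' (time_order tau))%:R) / (N ^ #|E|)%:R).
  rewrite /expect exchange_big /= mulr_suml; apply: eq_bigr => b _.
  rewrite exchange_big /= mulr_suml; apply: eq_bigr => b' _.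
  by rewrite mulrA mulr_sumr.
apply: (@le_trans _ _ (\sum_b \sum_b' wt b b' *
   ((\sum_(s : {perm E}) (Y b b' (perm_order s))%:R) / #|{perm E}|%:R + Kc / N%:R))).
  by apply: ler_sum => b _; apply: ler_sum => b' _; rewrite ler_wpM2l.
have -> : \sum_b \sum_b' wt b b' * ((\sum_(s : {perm E}) (Y b b' (perm_order s))%:R)
     / #|{perm E}|%:R + Kc / N%:R) =
   (\sum_b \sum_b' wt b b' * ((\sum_(s : {perm E}) (Y b b' (perm_order s))%:R)
     / #|{perm E}|%:R)) + (\sum_b \sum_b' wt b b') * Kc / N%:R.
  rewrite -mulrA mulr_suml -big_split; apply: eq_bigr => b _ /=.
  by rewrite mulr_suml -big_split; apply: eq_bigr => b' _ /=; rewrite mulrDr.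
rewrite lerD2r /selection_prob /Pr [leRHS]big_mkcond /=.
have -> : \sum_b \sum_b' wt b b' * ((\sum_(s : {perm E}) (Y b b' (perm_order s))%:R)
     / #|{perm E}|%:R) =
   \sum_(w : outcome G) outcome_pmf x a w * (Y w.1.2 w.2 (perm_order w.1.1))%:R.
  pose H (s : {perm E}) (b b' : {ffun E -> bool}) : R :=
    outcome_pmf x a (s, b, b') * (Y b b' (perm_order s))%:R.
  have -> : \sum_(w : outcome G) outcome_pmf x a w *
      (Y w.1.2 w.2 (perm_order w.1.1))%:R = \sum_s \sum_b \sum_b' H s b b'.
    by rewrite pair_bigA pair_bigA /=; apply: eq_bigr => -[[s b] b'] _.
  rewrite [RHS]exchange_big /=; apply: eq_bigr => b _.
  rewrite [RHS]exchange_big /=; apply: eq_bigr => b' _.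
  rewrite mulrA mulr_sumr mulr_suml; apply: eq_bigr => s _.
  by rewrite /H /outcome_pmf /wt /bern /active /attenuation_bit /=; ring.
apply: ler_sum => w _; have := witnesses_selected w fE.
have pmf0 : 0 <= outcome_pmf x a w.
  by rewrite /outcome_pmf -mulrA mulr_ge0 ?invr_ge0// wt0.
rewrite /Y /al -/(active w _) -/(attenuation_bit w _).
case: (f \in attenuate_rom w); last by rewrite leqn0 => /eqP ->; rewrite mulr0.
by rewrite -(ler_nat R) => h; rewrite -[leRHS]mulr1 ler_wpM2l.
Qed.

End Reduction.

Section Intro.
Variables (G : sgraph) (N : nat).
Local Notation E := (edge G).
Variables (tau : {ffun E -> 'I_N}) (al : pred E) (K : seq E).

Lemma side_none f u :
  (forall e, e \notin K -> u \in ends e -> ~~ (al e && (tau e < tau f)%N)) ->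
  (forall e, e \in K -> e != f -> u \notin ends e) ->
  side (time_order tau) al f u None.
Proof.
move=> H1 H2; apply/forallP => e; apply/implyP => /andP[ue ef].
rewrite /time_order -ltnNge; apply: H1 => //.
by apply/negP => /H2 /(_ ef); rewrite ue.
Qed.

(** The lateness conditions of a cylinder concern only edges outside its named list [K]; the last
    two hypotheses check the named edges themselves. *)
Lemma side_some f u g h : valid u f (g, h) -> al g -> al h ->
  (tau h <= tau g)%N -> (tau g <= tau f)%N ->
  (forall e, e \notin K -> u \in ends e -> ~~ (al e && (tau e < tau f)%N)) ->
  (forall e, e \notin K -> meets e h -> ~~ (al e && (tau e < tau h)%N)) ->
  (forall e, e \in K -> e != f -> e != g -> u \notin ends e) ->
  (forall e, e \in K -> e != h -> e != g -> meets e h -> (tau h <= tau e)%N) ->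
  side (time_order tau) al f u (Some (g, h)).
Proof.
move=> val_ ag ah hg gf H1 H2 H3 H4; rewrite /side val_ ag ah /time_order hg gf /=.
apply/andP; split; apply/forallP => e; apply/implyP => /and3P[ue ef eg];
  rewrite -ltnNge.
  by apply: H1 => //; apply/negP => /H3 /(_ ef eg); rewrite ue.
have [eK|eK] := boolP (e \in K); last exact: H2.
by rewrite negb_and -leqNgt H4 ?orbT.
Qed.

End Intro.

Section Lower.
Variables (R : realType) (G : sgraph) (x : edge G -> R) (N : nat).
Hypothesis xreg : one_regular x.
Hypothesis no3 : ~ has_cycle_of_length G 3.
Hypothesis no5 : ~ has_cycle_of_length G 5.
Hypothesis N0 : (0 < N)%N.
Local Notation E := (edge G).
Local Notation q := (fun e => @a2 R (x e)).
Local Notation p e := (x e * @a2 R (x e)).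
Local Notation T i := (i%:R / N%:R : R).
Local Notation Ex := (expect x q (N := N)).

Lemma x01 e : 0 <= x e <= 1. Proof. by case: xreg => -[]. Qed.

Lemma q01 e : 0 <= @a2 R (x e) <= 1.
Proof. by rewrite a2_le1 ?x01// ltW// a2_gt0// x01. Qed.

Lemma pq01 e : 0 <= p e <= 1. Proof. exact: (p01 x01 q01). Qed.

Lemma T01 i : (i <= N)%N -> 0 <= T i <= 1.
Proof. by move=> iN; rewrite divr_ge0//= ler_pdivrMr ?ltr0n// mul1r ler_nat. Qed.

Lemma sum_at h v : v \in ends h ->
  \sum_(e | (v \in ends e) && (e != h)) x e = 1 - x h.
Proof.
move=> vh; have [_ /(_ v) s] := xreg.
have -> : 1 = x h + \sum_(e | (v \in ends e) && (e != h)) x e.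
  rewrite -s (bigD1 h) ?inE//=; congr (_ + _).
  by apply: eq_bigl => e; rewrite inE.
by rewrite [RHS]addrC addKr.
Qed.

(** Each end of [h] carries weight [1 - x h] besides [h]; hence the factor 2 in the isolation
    exponents. *)
Lemma sum_meets h : \sum_(e | meets e h && (e != h)) x e <= 2 * (1 - x h).
Proof.
have [a ah] : exists a, a \in ends h.
  by apply/card_gt0P; rewrite (edges_card2 (svalP h)).
have [b ab hE] := other_end ah.
have bh : b \in ends h by rewrite hE !inE eqxx orbT.
rewrite mulrDl !mul1r -{1}(sum_at ah) -(sum_at bh).
rewrite [leLHS]big_mkcond [X in _ <= X + _]big_mkcond [X in _ <= _ + X]big_mkcond.
rewrite -big_split /=; apply: ler_sum => e _.
have /andP[x0 _] := x01 e.
have [/andP[mt eh]|_] := boolP (meets e h && (e != h)).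
  have /common_endP[z ze zh] := mt.
  rewrite eh !andbT; move: zh; rewrite hE !inE => /orP[]/eqP zE; rewrite -zE ze.
    by rewrite lerDl; case: ifP.
  by rewrite lerDr; case: ifP.
by rewrite addr_ge0//; case: ifP.
Qed.

Lemma isolated_bound (K : seq E) h j : h \in K -> (j <= N)%N ->
  expR (- (2 * (1 - x h) * T j)) <=
  \prod_(e | (e \notin K) && meets e h) (1 - p e * T j).
Proof.
move=> hK jN; have /andP[t0 t1] := T01 jN.
apply: (@le_trans _ _ (\prod_(e | (e \notin K) && meets e h) expR (- (T j * x e)))).
  rewrite -expR_sum ler_expR sumrN lerN2 -mulr_sumr mulrC ler_wpM2r//.
  apply: le_trans (sum_meets h).
  rewrite [leLHS]big_mkcond [leRHS]big_mkcond; apply: ler_sum => e _ /=.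
  have /andP[x0 _] := x01 e; case: (boolP (e \in K)) => /= [_|eK].
    by case: ifP.
  have -> : e != h by apply: contraNneq eK => ->.
  by rewrite andbT.
apply: ler_prod => e _; rewrite expR_ge0 [p e * _]mulrC.
by apply: survival; rewrite ?x01// t0 t1.
Qed.

Lemma miss01 e i : (i <= N)%N -> 0 <= miss (T i) (x e) <= 1.
Proof.
by move=> iN; have := late_factor x01 q01 N0 e iN; rewrite /miss [T i * _]mulrC.
Qed.

Lemma prod_miss_le (P Q : pred E) i : (i <= N)%N -> (forall e, Q e -> P e) ->
  \prod_(e | P e) miss (T i) (x e) <= \prod_(e | Q e) (1 - p e * T i).
Proof.
move=> iN QP; rewrite [leLHS]big_mkcond [leRHS]big_mkcond; apply: ler_prod => e _.
have /andP[m0 m1] := miss01 e iN.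
case: (boolP (Q e)) => [/QP ->|_].
  by rewrite m0 /miss [T i * _]mulrC /=.
by case: ifP => _; rewrite ?m0 ?m1 ?ler01 ?lexx.
Qed.

(** The index is read off the times by [key], so the cylinders are disjoint and their probabilities
    add up inside [ev]. *)
Lemma expect_disjoint (I : finType) (P : pred I)
    (key : {ffun E -> 'I_N} -> I)
    (sp : I -> seq (E * pred nat)) (cs : I -> seq (pred E * nat))
    (ev : {ffun E -> 'I_N} -> pred E -> bool) :
  (forall i tau al, P i -> rect (sp i) (cs i) tau al -> key tau = i /\ ev tau al) ->
  \sum_(i | P i) Ex (fun tau al => (rect (sp i) (cs i) tau al)%:R)
  <= Ex (fun tau al => (ev tau al)%:R).
Proof.
move=> H; rewrite -expect_sum; apply: (expect_le x01 q01) => tau al.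
have [/existsP[i /andP[Pi ri]]|/existsPn no] :=
  boolP [exists i, P i && rect (sp i) (cs i) tau al].
  have [ki ->] := H i tau al Pi ri.
  rewrite (bigD1 i)//= ri big1 ?addr0// => j /andP[Pj ji].
  case: (boolP (rect _ _ _ _)) => // /(H j tau al Pj)[kj _].
  by rewrite -kj ki eqxx in ji.
rewrite big1// => i Pi; case: (boolP (rect _ _ _ _)) => // ri.
by have := no i; rewrite Pi ri.
Qed.

Lemma special_eq e i : (i < N)%N ->
  p e / N%:R = p e * (#|[pred k : 'I_N | (k : nat) == i]|%:R / N%:R).
Proof.
move=> iN; rewrite (_ : #|_| = 1%N) ?mul1r//.
by rewrite -(card1 (Ordinal iN)); apply: eq_card => k; rewrite !inE.
Qed.

Lemma special_between e j i : (j <= i)%N -> (i < N)%N ->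
  p e * ((T i) - (T j)) <=
  p e * (#|[pred k : 'I_N | (j <= k <= i)%N]|%:R / N%:R).
Proof.
move=> ji iN; have /andP[p0 _] := pq01 e; rewrite ler_wpM2l// -mulrBl.
rewrite ler_wpM2r ?invr_ge0// -natrB// ler_nat.
have h (k : 'I_(i - j)) : (j + k < N)%N.
  by apply: (leq_ltn_trans _ iN); apply: ltnW; rewrite -ltn_subRL.
pose F k := Ordinal (h k).
have FI : injective F by move=> k l [/addnI/val_inj].
rewrite -[X in (X <= _)%N]card_ord -(card_imset _ FI).
apply: subset_leq_card; apply/subsetP => _ /imsetP[k _ ->].
by rewrite !inE /= leq_addr ltnW// -ltn_subRL.
Qed.

End Lower.

End Patterns.
Import Patterns.

(** * Probability of a given pair of certificates *)

Module Blocking.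

Section Lower2.
Variables (R : realType) (G : sgraph) (x : edge G -> R) (N : nat).
Hypothesis xreg : one_regular x.
Hypothesis no3 : ~ has_cycle_of_length G 3.
Hypothesis no5 : ~ has_cycle_of_length G 5.
Hypothesis N0 : (0 < N)%N.
Variables (f : edge G).
Local Notation E := (edge G).
Local Notation q := (fun e => @a2 R (x e)).
Local Notation p e := (x e * @a2 R (x e)).
Local Notation T i := (i%:R / N%:R : R).
Local Notation Ex := (expect x q (N := N)).
Local Notation X01 := (Patterns.x01 xreg).
Local Notation Q01 := (Patterns.q01 xreg).

Definition U u i : R := \prod_(e | (u \in ends e) && (e != f)) miss (T i) (x e).
Definition Ug u g i : R :=
  \prod_(e | ((u \in ends e) && (e != f)) && (e != g)) miss (T i) (x e).
(** Sum over the time [j] of a blocker of weight [y]: [T i - T j] is the room for the blocked edge,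
    the exponential bounds the isolation probability. *)
Definition K2 (i : nat) (y : R) : R :=
  N%:R^-1 * \sum_(j < N | (j < i)%N) (T i - T j) * expR (- (2 * (1 - y) * T j)).
(** The same for a common blocker: two edges must fall between [j] and [i]. *)
Definition K3 (i : nat) (y : R) : R :=
  N%:R^-1 * \sum_(j < N | (j < i)%N) (T i - T j) ^+ 2 * expR (- (2 * (1 - y) * T j)).
Definition at_time (e : E) (i : nat) : E * pred nat := (e, fun k => k == i).
Definition between (e : E) (j i : nat) : E * pred nat :=
  (e, fun k => (j <= k <= i)%N).
Definition late_at (u : G) (i : nat) : pred E * nat := (fun e => u \in ends e, i).
Definition late_near (h : E) (j : nat) : pred E * nat := (fun e => meets e h, j).
Definition evt u v A B (tau : {ffun E -> 'I_N}) (al : pred E) : bool :=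
  [&& al f, side (time_order tau) al f u A & side (time_order tau) al f v B].

Lemma p_ge0 e : 0 <= p e. Proof. by have /andP[] := pq01 xreg e. Qed.

Lemma U_ge0 u i : (i <= N)%N -> 0 <= U u i.
Proof. by move=> iN; apply: prodr_ge0 => e _; have /andP[] := miss01 xreg N0 e iN. Qed.

Lemma Ug_ge0 u g i : (i <= N)%N -> 0 <= Ug u g i.
Proof. by move=> iN; apply: prodr_ge0 => e _; have /andP[] := miss01 xreg N0 e iN. Qed.

Section TwoEnds.
Variables (u v : G).
Hypothesis uv : u != v.
Hypothesis fE : ends f = [set u; v].

Lemma uf : u \in ends f. Proof. by rewrite fE !inE eqxx. Qed.
Lemma vf : v \in ends f. Proof. by rewrite fE !inE eqxx orbT. Qed.

Lemma off_end g : u \in ends g -> g != f -> v \notin ends g.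
Proof.
move=> ug; apply: contraNN => vg; apply/eqP.
exact: (edge_eq uv ug vg uf vf).
Qed.

(** Otherwise [f], [g] and [h] would form a triangle. *)
Lemma valid_off g h : valid u f (g, h) -> v \notin ends h.
Proof.
case/and4P=> /= ug gf uh /common_endP[w wg wh]; apply/negP => vh.
have uw : u != w by apply: contraNneq uh => ->.
have vw : v != w by apply: contraNneq (off_end ug gf) => ->.
apply: (no_triangle no3 (edge_adj uv uf vf) (edge_adj vw vh wh)).
by rewrite adj_sym; exact: edge_adj uw ug wg.
Qed.

Lemma valid_neq g h : valid u f (g, h) -> [/\ g != f, h != f & h != g].
Proof.
case/and4P=> /= ug gf uh _; split=> //.
  by apply: contraNneq uh => ->; exact: uf.
by apply: contraNneq uh => ->.
Qed.

(** The blockers of [g] are the other edges at its far end, where regularity fixes the total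
    weight. *)
Lemma sum_valid g : u \in ends g -> g != f ->
  \sum_(h | (u \notin ends h) && meets g h) x h = 1 - x g.
Proof.
move=> ug gf; have [w uw gE] := other_end ug.
have wg : w \in ends g by rewrite gE !inE eqxx orbT.
rewrite -(sum_at xreg wg); apply: eq_bigl => h.
apply/andP/andP => [[uh /common_endP[z]]|[wh hg]].
  rewrite gE !inE => /orP[]/eqP -> zh; first by rewrite zh in uh.
  by split=> //; apply: contraNneq uh => ->.
split; last by apply/common_endP; exists w.
by apply: contra hg => uh; apply/eqP; exact: (edge_eq uw uh wh ug wg).
Qed.

Lemma bound_none : N%:R^-1 * \sum_(i < N) p f * (U u i * U v i)
  <= Ex (fun tau al => (evt u v None None tau al)%:R).
Proof.
apply: le_trans (expect_disjoint xreg (P := xpredT) (key := fun tau => tau f)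
  (sp := fun i => [:: at_time f i])
  (cs := fun i => [:: late_at u i; late_at v i]) _).
  rewrite mulr_sumr; apply: ler_sum => i _.
  have iN := ltnW (ltn_ord i).
  apply: le_trans (rect_bound X01 Q01 N0 _ _); last 2 first.
  - by [].
  - by move=> c /= [<-|[<-|[]]].
  rewrite !big_cons !big_nil !mulr1 /= -(special_eq x _ (ltn_ord i)).
  rewrite [leLHS](_ : _ = p f / N%:R * (U u i * U v i)); last by ring.
  apply: ler_wpM2l; first by rewrite divr_ge0 ?p_ge0.
  apply: ler_pM; rewrite ?U_ge0//; apply: (prod_miss_le xreg N0 iN) => e;
    by rewrite !inE andbC.
move=> i tau al _; rewrite /rect /= !andbT => /andP[/andP[af /eqP tf]].
move=> /andP[/forallP cu /forallP cv]; split; first exact: val_inj.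
rewrite /evt af /=; apply/andP; split; apply: (side_none (K := [:: f])) => e.
- by rewrite tf => eK ue; have := cu e; rewrite eK ue.
- by rewrite inE => ->.
- by rewrite tf => eK ve; have := cv e; rewrite eK ve.
- by rewrite inE => ->.
Qed.

(** One cylinder for each pair of times of [f] and [h]; [g] is only confined between them. *)
Lemma bound_one g h : valid u f (g, h) ->
  N%:R^-1 * \sum_(i < N) p f * (Ug u g i * p g * (p h * K2 i (x h)) * U v i)
  <= Ex (fun tau al => (evt u v (Some (g, h)) None tau al)%:R).
Proof.
move=> vgh; have [gf hf hg] := valid_neq vgh; have vh := valid_off vgh.
have /and4P[/= ug _ uh mgh] := vgh; have vg := off_end ug gf.
apply: le_trans (expect_disjoint xreg
  (P := fun ij : 'I_N * 'I_N => (ij.2 < ij.1)%N) (key := fun tau => (tau f, tau h))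
  (sp := fun ij => [:: at_time f ij.1; between g ij.2 ij.1; at_time h ij.2])
  (cs := fun ij => [:: late_at u ij.1; late_at v ij.1; late_near h ij.2]) _).
  rewrite (_ : N%:R^-1 * _ = \sum_(i < N) \sum_(j < N | (j < i)%N)
      (p f / N%:R * (p g * (T i - T j) * (p h / N%:R))) *
      (Ug u g i * (U v i * expR (- (2 * (1 - x h) * T j))))); last first.
    rewrite mulr_sumr; apply: eq_bigr => i _.
    rewrite /K2 !mulr_sumr !mulr_suml !mulr_sumr; apply: eq_bigr => j _; ring.
  rewrite pair_big_dep; apply: ler_sum => -[i j] /= ji.
  have iN := ltnW (ltn_ord i); have jN := ltnW (ltn_ord j).
  apply: le_trans (rect_bound X01 Q01 N0 _ _); last 2 first.
  - by rewrite /= !inE !negb_or (eq_sym f g) gf (eq_sym f h) hf (eq_sym g h) hg.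
  - by move=> c /= [<-|[<-|[<-|[]]]].
  rewrite !big_cons !big_nil !mulr1 /= -(special_eq x f (ltn_ord i)) -(special_eq x h (ltn_ord j)).
  have T0 : 0 <= T i - T j by rewrite -mulrBl -natrB ?(ltnW ji)// divr_ge0.
  have pN e : 0 <= p e / N%:R by rewrite divr_ge0 ?p_ge0.
  apply: ler_pM.
  - exact: mulr_ge0 (pN f) (mulr_ge0 (mulr_ge0 (p_ge0 g) T0) (pN h)).
  - exact: mulr_ge0 (Ug_ge0 u g iN) (mulr_ge0 (U_ge0 v iN) (expR_ge0 _)).
  - apply: (ler_wpM2l (pN f)); apply: (ler_wpM2r (pN h)).
    exact: (special_between xreg g (ltnW ji) (ltn_ord i)).
  apply: ler_pM; [exact: Ug_ge0|exact: mulr_ge0 (U_ge0 v iN) (expR_ge0 _)| |].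
    apply: (prod_miss_le xreg N0 iN) => e.
    by rewrite !inE !negb_or => /andP[/and3P[-> -> _] ->].
  apply: ler_pM; [exact: U_ge0|exact: expR_ge0| |].
    apply: (prod_miss_le xreg N0 iN) => e.
    by rewrite !inE !negb_or => /andP[/and3P[-> _ _] ->].
  by apply: (isolated_bound xreg N0 _ jN); rewrite !inE eqxx !orbT.
move=> [i j] tau al /= ji; rewrite /rect /= !andbT.
move=> /andP[/and3P[/andP[af /eqP tf] /andP[ag /andP[jg gi]] /andP[ah /eqP th]]].
move=> /and3P[/forallP cu /forallP cv /forallP ch].
split; first by congr pair; exact: val_inj.
rewrite /evt af /=; apply/andP; split.
  apply: (side_some (K := [:: f; g; h])) => //; rewrite ?tf ?th//.
  - by move=> e eK ue; have := cu e; rewrite eK ue.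
  - by move=> e eK eh; have := ch e; rewrite eK eh.
  - by move=> e; rewrite !inE => /or3P[]/eqP-> //; rewrite eqxx.
  - by move=> e; rewrite !inE => /or3P[]/eqP-> //; rewrite ?eqxx// tf ltnW.
apply: (side_none (K := [:: f; g; h])) => e; rewrite ?tf.
- by move=> eK ve; have := cv e; rewrite eK ve.
- by rewrite !inE => /or3P[]/eqP-> //; rewrite eqxx.
Qed.

End TwoEnds.

Section BothBlocked.
Variables (u v : G).
Hypothesis uv : u != v.
Hypothesis fE : ends f = [set u; v].
Variables (g h g' h' : E).
Hypothesis vgh : valid u f (g, h).
Hypothesis vgh' : valid v f (g', h').

Lemma fE_sym : ends f = [set v; u]. Proof. by rewrite fE setUC. Qed.
Lemma vu : v != u. Proof. by rewrite eq_sym. Qed.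

Lemma both_off : [/\ u \in ends g, v \notin ends g, v \in ends g',
  u \notin ends g' & [/\ u \notin ends h, v \notin ends h, u \notin ends h' &
  v \notin ends h']].
Proof.
have /and4P[/= ug gf uh _] := vgh; have /and4P[/= vg' gf' vh' _] := vgh'.
split=> //.
- exact: (off_end uv fE ug gf).
- exact: (off_end vu fE_sym vg' gf').
split=> //; first exact: (valid_off uv fE vgh).
exact: (valid_off vu fE_sym vgh').
Qed.

Lemma both_neq : [/\ g != g', h != g' & h' != g].
Proof.
have [ug vg vg' ug' [uh vh uh' vh']] := both_off; split.
- by apply: contraNneq vg => ->.
- by apply: contraNneq vh => ->.
- by apply: contraNneq uh' => ->.
Qed.

(** A common end [z] of the blockers would close the 5-cycle [u w z w' v] through [g], [h], [h'],
    [g'] and [f]. *)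
Lemma no_common_blocker : ~~ meets g h' -> ~~ meets g' h -> ~~ meets h h'.
Proof.
have [ug vg vg' ug' [uh vh uh' vh']] := both_off.
move=> gh' g'h; apply/negP => /common_endP[z zh zh'].
have /and4P[_ _ _ /common_endP[/= w wg wh]] := vgh.
have /and4P[_ _ _ /common_endP[/= w' wg' wh']] := vgh'.
have notin (k : E) (a b : G) : a \in ends k -> b \notin ends k -> a != b.
  by move=> ak; apply: contraNneq => <-.
have wh'N : w \notin ends h'.
  by apply: contra gh' => wN; apply/common_endP; exists w.
have w'hN : w' \notin ends h.
  by apply: contra g'h => w'h; apply/common_endP; exists w'.
have uw : u != w by rewrite eq_sym (notin h).
have wz : w != z by rewrite eq_sym (notin h').
have zw' : z != w' by rewrite (notin h).
have w'v : w' != v by rewrite (notin h').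
apply: (@no_pentagon _ u w z w' v no5).
- rewrite /= !inE !negb_or uw wz zw' w'v uv.
  rewrite (eq_sym u z) (notin h z u)// (eq_sym u w') (notin h' w' u)//.
  by rewrite (notin h w w')// (notin h w v)// (notin h z v).
- exact: edge_adj uw ug wg.
- exact: edge_adj wz wh zh.
- exact: edge_adj zw' zh' wh'.
- exact: edge_adj w'v wg' vg'.
- exact: edge_adj vu (vf fE) (uf fE).
Qed.

(** The excluded pairs are hopeless when [h] and [h'] differ: an [h] meeting [g'] shares with [h']
    the far end of [g'], and both cannot be isolated. *)
Lemma bound_two : ~~ meets g h' -> ~~ meets g' h ->
  N%:R^-1 * \sum_(i < N) p f * (Ug u g i * p g * (Ug v g' i * p g')) *
    ((p h * K2 i (x h)) * (p h' * K2 i (x h')))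
  <= Ex (fun tau al => (evt u v (Some (g, h)) (Some (g', h')) tau al)%:R).
Proof.
move=> gh' g'h; have hh' := no_common_blocker gh' g'h.
have [gf hf hg] := valid_neq fE vgh.
have [gf' hf' hg'] := valid_neq fE_sym vgh'.
have [ug vg vg' ug' [uh vh uh' vh']] := both_off.
have [gg' hg'N h'gN] := both_neq.
have hh'N : h != h'.
  apply: contraNneq hh' => <-; have /and4P[_ _ _ /common_endP[w _ wh]] := vgh.
  by apply/common_endP; exists w.
have nfh : ~~ meets f h.
  by apply/negP => /common_endP[z]; rewrite fE !inE => /orP[]/eqP -> zh; move: uh vh; rewrite zh.
have nfh' : ~~ meets f h'.
  by apply/negP => /common_endP[z]; rewrite fE !inE => /orP[]/eqP -> zh; move: uh' vh'; rewrite zh.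
apply: le_trans (expect_disjoint xreg
  (P := fun t : 'I_N * ('I_N * 'I_N) => (t.2.1 < t.1)%N && (t.2.2 < t.1)%N)
  (key := fun tau => (tau f, (tau h, tau h')))
  (sp := fun t => [:: at_time f t.1; between g t.2.1 t.1; at_time h t.2.1;
    between g' t.2.2 t.1; at_time h' t.2.2])
  (cs := fun t => [:: late_at u t.1; late_at v t.1; late_near h t.2.1;
    late_near h' t.2.2]) _).
  rewrite (_ : N%:R^-1 * _ = \sum_(i < N) \sum_(jj : 'I_N * 'I_N |
        (jj.1 < i)%N && (jj.2 < i)%N)
      (p f / N%:R * ((p g * (T i - T jj.1) * (p h / N%:R)) *
         (p g' * (T i - T jj.2) * (p h' / N%:R)))) *
      (Ug u g i * (Ug v g' i * (expR (- (2 * (1 - x h) * T jj.1)) *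
         expR (- (2 * (1 - x h') * T jj.2)))))); last first.
    rewrite mulr_sumr; apply: eq_bigr => i _.
    rewrite -(pair_big_dep (fun j : 'I_N => (j < i)%N) (fun _ (j : 'I_N) => (j < i)%N)
      (fun j j' => (p f / N%:R * ((p g * (T i - T j) * (p h / N%:R)) *
         (p g' * (T i - T j') * (p h' / N%:R)))) *
      (Ug u g i * (Ug v g' i * (expR (- (2 * (1 - x h) * T j)) *
         expR (- (2 * (1 - x h') * T j'))))))) /=.
    rewrite /K2 !(mulrA (p h)) !(mulrA (p h')).
    rewrite (mulrACA (p h / N%:R)) big_distrlr /= !mulr_sumr; apply: eq_bigr => j _.
    rewrite !mulr_sumr; apply: eq_bigr => j' _; ring.
  rewrite pair_big_dep; apply: ler_sum => -[i [j j']] /= /andP[ji ji'].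
  have iN := ltnW (ltn_ord i); have jN := ltnW (ltn_ord j).
  have jN' := ltnW (ltn_ord j').
  apply: le_trans (rect_bound X01 Q01 N0 _ _); last 2 first.
  - rewrite /= !inE !negb_or (eq_sym f g) gf (eq_sym f h) hf (eq_sym g h) hg.
    rewrite (eq_sym f g') gf' (eq_sym f h') hf' gg' (eq_sym g h') h'gN hg'N hh'N.
    by rewrite (eq_sym g' h') hg'.
  - by move=> c /= [<-|[<-|[<-|[<-|[]]]]].
  rewrite !big_cons !big_nil !mulr1 /= -(special_eq x f (ltn_ord i)).
  rewrite -(special_eq x h (ltn_ord j)) -(special_eq x h' (ltn_ord j')).
  have T0 k : (k < i)%N -> 0 <= T i - T k.
    by move=> ki; rewrite -mulrBl -natrB ?(ltnW ki)// divr_ge0.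
  have pN e : 0 <= p e / N%:R by rewrite divr_ge0 ?p_ge0.
  have sb e k : (k < i)%N -> p e * (T i - T k) <=
      p e * (#|[pred l : 'I_N | (k <= l <= i)%N]|%:R / N%:R).
    by move=> ki; exact: (special_between xreg e (ltnW ki) (ltn_ord i)).
  have n1 := mulr_ge0 (mulr_ge0 (p_ge0 g) (T0 j ji)) (pN h).
  have n2 := mulr_ge0 (mulr_ge0 (p_ge0 g') (T0 j' ji')) (pN h').
  have ee := mulr_ge0 (expR_ge0 (- (2 * (1 - x h) * T j)))
    (expR_ge0 (- (2 * (1 - x h') * T j'))).
  apply: ler_pM.
  - exact: mulr_ge0 (pN f) (mulr_ge0 n1 n2).
  - exact: mulr_ge0 (Ug_ge0 u g iN) (mulr_ge0 (Ug_ge0 v g' iN) ee).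
  - apply: (ler_wpM2l (pN f)); rewrite [leRHS]mulrA; apply: ler_pM => //.
      by apply: (ler_wpM2r (pN h)); exact: sb.
    by apply: (ler_wpM2r (pN h')); exact: sb.
  apply: ler_pM; [exact: Ug_ge0|exact: mulr_ge0 (Ug_ge0 v g' iN) ee| |].
    apply: (prod_miss_le xreg N0 iN) => e.
    by rewrite !inE !negb_or => /andP[/and5P[-> -> _ _ _] ->].
  apply: ler_pM; [exact: Ug_ge0|exact: ee| |].
    apply: (prod_miss_le xreg N0 iN) => e.
    by rewrite !inE !negb_or => /andP[/and5P[-> _ _ -> _] ->].
  apply: ler_pM; rewrite ?expR_ge0//.
    by apply: (isolated_bound xreg N0 _ jN); rewrite !inE eqxx !orbT.
  by apply: (isolated_bound xreg N0 _ jN'); rewrite !inE eqxx !orbT.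
move=> [i [j j']] tau al /= ji; rewrite /rect /= !andbT.
move=> /andP[/and5P[/andP[af /eqP tf] /andP[ag /andP[jg gi]] /andP[ah /eqP th]
  /andP[ag' /andP[jg' gi']] /andP[ah' /eqP th']]].
move=> /and4P[/forallP cu /forallP cv /forallP ch /forallP ch'].
split; first by do 2?congr pair; exact: val_inj.
rewrite /evt af /=; apply/andP; split.
  apply: (side_some (K := [:: f; g; h; g'; h'])) => //; rewrite ?tf ?th//.
  - by move=> e eK ue; have := cu e; rewrite eK ue.
  - by move=> e eK eh; have := ch e; rewrite eK eh.
  - by move=> e; rewrite !inE => /orP[|/or4P[]] /eqP-> //; rewrite eqxx.
  (* The isolation of [h] among named edges: [f], [g'] and [h'] do not meet it. *)
  - move=> e; rewrite !inE => /orP[|/or4P[]] /eqP-> //; rewrite ?eqxx//.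
    + by rewrite (negbTE nfh).
    + by rewrite (negbTE g'h).
    + by rewrite meetsC (negbTE hh').
apply: (side_some (K := [:: f; g; h; g'; h'])) => //; rewrite ?tf ?th'//.
- by move=> e eK ue; have := cv e; rewrite eK ue.
- by move=> e eK eh; have := ch' e; rewrite eK eh.
- by move=> e; rewrite !inE => /orP[|/or4P[]] /eqP-> //; rewrite eqxx.
- move=> e; rewrite !inE => /orP[|/or4P[]] /eqP-> //; rewrite ?eqxx//.
  + by rewrite (negbTE nfh').
  + by rewrite (negbTE gh').
  + by rewrite (negbTE hh').
Qed.

(** Here [g] and [g'] do meet the isolated [h], but both are confined to times after it. *)
Lemma bound_common : h = h' ->
  N%:R^-1 * \sum_(i < N) p f * (Ug u g i * p g * (Ug v g' i * p g')) *
    (p h * K3 i (x h))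
  <= Ex (fun tau al => (evt u v (Some (g, h)) (Some (g', h)) tau al)%:R).
Proof.
move=> hh'; have [gf hf hg] := valid_neq fE vgh.
have [gf' hf' hg'] := valid_neq fE_sym vgh'.
have [ug vg vg' ug' [uh vh uh' vh']] := both_off.
have [gg' hg'N h'gN] := both_neq.
have vg'h : valid v f (g', h) by rewrite hh'.
have nfh : ~~ meets f h.
  by apply/negP => /common_endP[z]; rewrite fE !inE => /orP[]/eqP -> zh; move: uh vh; rewrite zh.
apply: le_trans (expect_disjoint xreg
  (P := fun ij : 'I_N * 'I_N => (ij.2 < ij.1)%N) (key := fun tau => (tau f, tau h))
  (sp := fun ij => [:: at_time f ij.1; between g ij.2 ij.1;
    between g' ij.2 ij.1; at_time h ij.2])
  (cs := fun ij => [:: late_at u ij.1; late_at v ij.1; late_near h ij.2]) _).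
  rewrite (_ : N%:R^-1 * _ = \sum_(i < N) \sum_(j < N | (j < i)%N)
      (p f / N%:R * (p g * (T i - T j) * (p g' * (T i - T j) * (p h / N%:R)))) *
      (Ug u g i * (Ug v g' i * expR (- (2 * (1 - x h) * T j))))); last first.
    rewrite mulr_sumr; apply: eq_bigr => i _.
    rewrite /K3 !mulr_sumr; apply: eq_bigr => j _; ring.
  rewrite pair_big_dep; apply: ler_sum => -[i j] /= ji.
  have iN := ltnW (ltn_ord i); have jN := ltnW (ltn_ord j).
  apply: le_trans (rect_bound X01 Q01 N0 _ _); last 2 first.
  - rewrite /= !inE !negb_or (eq_sym f g) gf (eq_sym f h) hf (eq_sym g h) hg.
    by rewrite (eq_sym f g') gf' gg' (eq_sym g' h) hg'N.
  - by move=> c /= [<-|[<-|[<-|[]]]].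
  rewrite !big_cons !big_nil !mulr1 /= -(special_eq x f (ltn_ord i)).
  rewrite -(special_eq x h (ltn_ord j)).
  have T0 : 0 <= T i - T j by rewrite -mulrBl -natrB ?(ltnW ji)// divr_ge0.
  have pN e : 0 <= p e / N%:R by rewrite divr_ge0 ?p_ge0.
  have sb e := special_between xreg e (ltnW ji) (ltn_ord i).
  have n1 := mulr_ge0 (p_ge0 g) T0.
  have n2 := mulr_ge0 (mulr_ge0 (p_ge0 g') T0) (pN h).
  have e0 := expR_ge0 (- (2 * (1 - x h) * T j)).
  apply: ler_pM.
  - exact: mulr_ge0 (pN f) (mulr_ge0 n1 n2).
  - exact: mulr_ge0 (Ug_ge0 u g iN) (mulr_ge0 (Ug_ge0 v g' iN) e0).
  - apply: (ler_wpM2l (pN f)); apply: ler_pM => //.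
    by apply: (ler_wpM2r (pN h)).
  apply: ler_pM; [exact: Ug_ge0|exact: mulr_ge0 (Ug_ge0 v g' iN) e0| |].
    apply: (prod_miss_le xreg N0 iN) => e.
    by rewrite !inE !negb_or => /andP[/and4P[-> -> _ _] ->].
  apply: ler_pM; [exact: Ug_ge0|exact: e0| |].
    apply: (prod_miss_le xreg N0 iN) => e.
    by rewrite !inE !negb_or => /andP[/and4P[-> _ -> _] ->].
  by apply: (isolated_bound xreg N0 _ jN); rewrite !inE eqxx !orbT.
move=> [i j] tau al /= ji; rewrite /rect /= !andbT.
move=> /andP[/and4P[/andP[af /eqP tf] /andP[ag /andP[jg gi]]
  /andP[ag' /andP[jg' gi']] /andP[ah /eqP th]]].
move=> /and3P[/forallP cu /forallP cv /forallP ch].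
split; first by congr pair; exact: val_inj.
rewrite /evt af /=; apply/andP; split;
  apply: (side_some (K := [:: f; g; g'; h])) => //; rewrite ?tf ?th//.
- by move=> e eK ue; have := cu e; rewrite eK ue.
- by move=> e eK eh; have := ch e; rewrite eK eh.
- by move=> e; rewrite !inE => /or4P[]/eqP-> //; rewrite eqxx.
- by move=> e; rewrite !inE => /or4P[]/eqP-> //; rewrite ?eqxx// (negbTE nfh).
- by move=> e eK ue; have := cv e; rewrite eK ue.
- by move=> e eK eh; have := ch e; rewrite eK eh.
- by move=> e; rewrite !inE => /or4P[]/eqP-> //; rewrite eqxx.
- by move=> e; rewrite !inE => /or4P[]/eqP-> //; rewrite ?eqxx// (negbTE nfh).
Qed.

End BothBlocked.
End Lower2.

End Blocking.
Import Blocking.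

(** * Summation over the blockers *)

Module Averaging.

Section Assembly.
Variables (R : realType) (G : sgraph) (x : edge G -> R) (N : nat).
Hypothesis xreg : one_regular x.
Hypothesis no3 : ~ has_cycle_of_length G 3.
Hypothesis no5 : ~ has_cycle_of_length G 5.
Hypothesis N0 : (0 < N)%N.
Local Notation E := (edge G).
Local Notation q := (fun e => @a2 R (x e)).
Local Notation p e := (x e * @a2 R (x e)).
Local Notation T i := (i%:R / N%:R : R).
Local Notation Ex := (expect x q (N := N)).
Local Notation c := (@c R).
Local Notation X01 := (Patterns.x01 xreg).
Local Notation K2 := (@Blocking.K2 R N).
Local Notation K3 := (@Blocking.K3 R N).

Lemma c_ge0 : 0 <= c.
Proof. by have /andP[c1 _] := c_bounds R; lra. Qed.

(* The grid [j/N], [j < i], is the grid [j/i] of [0, 1] rescaled by [i/N <= 1]. *)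
Lemma rescale n (i : nat) (y : R) : (0 < i)%N -> (i <= N)%N -> y <= 1 ->
  T i ^+ n.+1 * (i%:R^-1 * \sum_(j < i)
    (1 - j%:R / i%:R) ^+ n * expR (- (2 * (1 - y) * (j%:R / i%:R))))
  <= N%:R^-1 * \sum_(j < N | (j < i)%N)
    (T i - T j) ^+ n * expR (- (2 * (1 - y) * T j)).
Proof.
move=> i0 iN y1; have i0R : i%:R != 0 :> R by rewrite pnatr_eq0 -lt0n.
have N0R : N%:R != 0 :> R by rewrite pnatr_eq0 -lt0n.
have Ti : T i * i%:R^-1 = N%:R^-1 by field; rewrite i0R N0R.
rewrite (big_ord_narrow iN) /= exprSr -mulrA (mulrA (T i)) Ti mulrCA.
apply: ler_wpM2l; first by rewrite invr_ge0.
rewrite mulr_sumr; apply: ler_sum => j _.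
rewrite mulrA -exprMn.
have -> : T i * (1 - j%:R / i%:R) = T i - T j by field; rewrite i0R N0R.
apply: ler_wpM2l.
  by rewrite exprn_ge0// -mulrBl -natrB ?divr_ge0// ltnW.
rewrite ler_expR lerN2 -!mulrA ler_wpM2l// ler_wpM2l ?subr_ge0//.
by rewrite ler_wpM2l// lef_pV2 ?posrE ?ltr0n// ler_nat.
Qed.

Lemma K2_bound (i : nat) (y : R) : (i <= N)%N -> 0 <= y <= 1 ->
  c * T i ^+ 2 <= @a2 R y * K2 i y.
Proof.
move=> iN y01; have /andP[_ y1] := y01.
(* At time 0 there is no grid to rescale, and both sides are 0. *)
have [->|i0] := posnP i.
  rewrite mul0r expr0n mulr0 /Blocking.K2 big_pred0 ?mulr0//.
have := rescale 1 i0 iN y1; rewrite (eq_bigr _ (fun j _ => erefl)) => h.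
apply: le_trans (ler_wpM2l (ltW (a2_gt0 y01)) h).
rewrite [leLHS]mulrC.
apply: le_trans (ler_wpM2l (sqr_ge0 (T i)) (blocker_mean y01 i0)) _.
by rewrite mulrCA; exact: lexx.
Qed.

(** [double_blocker_mean] yields [2 / 3 * c * T i ^+ 3], which suffices since [c <= 1 / 3] and
    [T i <= 1]. So a common blocker is worth twice the product of two separate ones. *)
Lemma K3_bound (i : nat) (y : R) : (i <= N)%N -> 0 <= y <= 1 ->
  2 * (c * T i ^+ 2) ^+ 2 <= @a2 R y * K3 i y.
Proof.
move=> iN y01; have /andP[_ y1] := y01.
have [->|i0] := posnP i.
  rewrite mul0r expr0n mulr0 expr0n mulr0 /Blocking.K3 big_pred0 ?mulr0//.
apply: le_trans (ler_wpM2l (ltW (a2_gt0 y01)) (rescale 2 i0 iN y1)).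
rewrite [leRHS]mulrCA; have /andP[t0 t1] := Patterns.T01 R N0 iN.
apply: le_trans (ler_wpM2l (exprn_ge0 3 t0) (double_blocker_mean y01 i0)).
rewrite [leLHS](_ : _ = T i ^+ 3 * (2 * (c * c) * T i)); last by ring.
apply: ler_wpM2l; first by rewrite exprn_ge0.
have /andP[c1 c2] := c_bounds R.
have cc : 2 * (c * c) <= 2 / 3 * c by move: (c) c1 c2 => k *; nra.
apply: le_trans cc; rewrite ler_piMr// mulr_ge0//.
by rewrite mulr_ge0 ?c_ge0.
Qed.

Section Edge.
Variables (f : E) (u v : G).
Hypothesis uv : u != v.
Hypothesis fE : ends f = [set u; v].
Local Notation U := (U x N f).
Local Notation Ug := (Ug x N f).
Local Notation evt := (@evt G N f).
Local Notation C i := (c * T i ^+ 2).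
Local Notation at_end u g := ((u \in ends g) && (g != f)).
Local Notation F A B := (Ex (fun tau al => (evt u v A B tau al)%:R)).

(** The right side of [side_bound] at time [T i]. *)
Definition S (u : G) i : R :=
  U u i + \sum_(g | at_end u g) Ug u g i * (p g * (C i * (1 - x g))).

Lemma valid_sym g g' h : at_end v g' -> u \notin ends h -> meets g h ->
  at_end u g -> meets g' h -> valid v f (g', h).
Proof.
move=> /andP[vg' gf'] uh gh /andP[ug gf] g'h.
rewrite /valid /= vg' gf' g'h andbT /=.
by apply: (@valid_off _ no3 f u v uv fE g); rewrite /valid /= ug gf uh.
Qed.

(** Let [k] be the weight of the common blockers and [s1], [s2] the remaining weights. Then
    [(k + s1) * (k + s2) <= 2 * k + s1 * s2], because [k + s1 <= 1] and [s2 <= 1]; the 2 comes from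
    [K3_bound]. *)
Lemma blockers_pair g g' i : (i <= N)%N -> at_end u g -> at_end v g' ->
  (C i * (1 - x g)) * (C i * (1 - x g')) <=
  \sum_(h | (u \notin ends h) && meets g h && meets g' h) p h * K3 i (x h) +
  (\sum_(h | (u \notin ends h) && meets g h && ~~ meets g' h) p h * K2 i (x h)) *
  (\sum_(h | (v \notin ends h) && meets g' h && ~~ meets g h) p h * K2 i (x h)).
Proof.
move=> iN ug vg'; have Ci : 0 <= C i by rewrite mulr_ge0 ?c_ge0 ?sqr_ge0.
have /andP[ug_ gf] := ug; have /andP[vg_ gf'] := vg'.
have fE' : ends f = [set v; u] by rewrite fE setUC.
have vu : v != u by rewrite eq_sym.
pose k := \sum_(h | (u \notin ends h) && meets g h && meets g' h) x h.
pose s1 := \sum_(h | (u \notin ends h) && meets g h && ~~ meets g' h) x h.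
pose s2 := \sum_(h | (v \notin ends h) && meets g' h && ~~ meets g h) x h.
have x0 h : 0 <= x h by have /andP[] := X01 h.
have k0 : 0 <= k by exact: sumr_ge0.
have s10 : 0 <= s1 by exact: sumr_ge0.
have s20 : 0 <= s2 by exact: sumr_ge0.
have e1 : 1 - x g = k + s1.
  by rewrite -(sum_valid xreg ug_ gf) (bigID (meets g')).
have e2 : 1 - x g' = k + s2.
  rewrite -(sum_valid xreg vg_ gf') (bigID (meets g)) /=; congr (_ + _).
  apply: eq_bigl => h; apply/andP/andP => [[/andP[vh g'h] gh]|[/andP[uh gh] g'h]].
    split=> //; rewrite gh andbT.
    by apply: (@valid_off _ no3 f v u vu fE' g'); rewrite /valid /= vg_ gf' vh.
  split=> //; rewrite g'h andbT.
  by apply: (@valid_off _ no3 f u v uv fE g); rewrite /valid /= ug_ gf uh.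
have L1 : s1 * C i <= \sum_(h | (u \notin ends h) && meets g h && ~~ meets g' h)
    p h * K2 i (x h).
  rewrite mulr_suml; apply: ler_sum => h _; rewrite -mulrA ler_wpM2l//.
  exact: (K2_bound iN (X01 h)).
have L2 : s2 * C i <= \sum_(h | (v \notin ends h) && meets g' h && ~~ meets g h)
    p h * K2 i (x h).
  rewrite mulr_suml; apply: ler_sum => h _; rewrite -mulrA ler_wpM2l//.
  exact: (K2_bound iN (X01 h)).
have L3 : k * (2 * (C i) ^+ 2) <=
    \sum_(h | (u \notin ends h) && meets g h && meets g' h) p h * K3 i (x h).
  rewrite mulr_suml; apply: ler_sum => h _; rewrite -mulrA ler_wpM2l//.
  exact: (K3_bound iN (X01 h)).
have L12 := ler_pM (mulr_ge0 s10 Ci) (mulr_ge0 s20 Ci) L1 L2.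
apply: le_trans (lerD L3 L12).
rewrite e1 e2 -subr_ge0.
rewrite [leRHS](_ : _ = (C i) ^+ 2 * (k * (2 - (k + s1) - s2))); last by ring.
rewrite mulr_ge0 ?sqr_ge0// mulr_ge0//.
by have := x0 g; have := x0 g'; lra.
Qed.

Lemma expect_ge0 A B : 0 <= F A B.
Proof.
rewrite divr_ge0//; apply: sumr_ge0 => tau _; apply: sumr_ge0 => a _.
apply: sumr_ge0 => b _; rewrite mulr_ge0// mulr_ge0//; apply: bern_ge0 => e.
  exact: X01.
exact: Patterns.q01.
Qed.

Lemma avg_sum (I : finType) (P : pred I) (Z : nat -> I -> R) :
  N%:R^-1 * \sum_(i < N) \sum_(g | P g) Z i g
  = \sum_(g | P g) N%:R^-1 * \sum_(i < N) Z i g.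
Proof. by rewrite exchange_big mulr_sumr. Qed.

Lemma avg_le (Z Z' : 'I_N -> R) : (forall i, Z i <= Z' i) ->
  N%:R^-1 * \sum_(i < N) Z i <= N%:R^-1 * \sum_(i < N) Z' i.
Proof.
by move=> h; rewrite ler_wpM2l ?invr_ge0//; apply: ler_sum => i _; exact: h.
Qed.

Lemma sum_one_side g : at_end u g ->
  N%:R^-1 * \sum_(i < N) p f * (Ug u g i * (p g * (C i * (1 - x g))) * U v i)
  <= \sum_(h | (u \notin ends h) && meets g h) F (Some (g, h)) None.
Proof.
move=> ug; have /andP[ug_ gf] := ug.
apply: (@le_trans _ _ (\sum_(h | (u \notin ends h) && meets g h) N%:R^-1 *
   \sum_(i < N) p f * (Ug u g i * p g * (p h * K2 i (x h)) * U v i))); last first.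
  apply: ler_sum => h /andP[uh gh]; apply: bound_one => //.
  by rewrite /valid /= ug_ gf uh.
rewrite -(avg_sum _ (fun i h => p f * (Ug u g i * p g * (p h * K2 i (x h)) * U v i))).
apply: avg_le => i; have iN := ltn_ord i; rewrite -mulr_sumr -mulr_suml -mulr_sumr.
apply: ler_wpM2l; first exact: (p_ge0 xreg f).
apply: ler_wpM2r; first exact: (U_ge0 xreg N0 _ _ (ltnW iN)).
rewrite mulrA; apply: ler_wpM2l.
  exact: mulr_ge0 (Ug_ge0 xreg N0 _ _ _ (ltnW iN)) (p_ge0 xreg _).
rewrite -(sum_valid xreg ug_ gf) mulr_sumr; apply: ler_sum => h _.
rewrite mulrC -mulrA ler_wpM2l//; first by have /andP[] := X01 h.
exact: K2_bound (ltnW iN) (X01 h).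
Qed.

(** For a blocker [h] that also meets [g'], keep only [h' = h]; for any other, keep only the [h']
    that miss [g]. The discarded terms are nonnegative. *)
Lemma sum_two_sides g g' : at_end u g -> at_end v g' ->
  N%:R^-1 * \sum_(i < N) p f * ((Ug u g i * (p g * (C i * (1 - x g)))) *
    (Ug v g' i * (p g' * (C i * (1 - x g')))))
  <= \sum_(h | (u \notin ends h) && meets g h)
     \sum_(h' | (v \notin ends h') && meets g' h') F (Some (g, h)) (Some (g', h')).
Proof.
move=> ug vg'; have /andP[ug_ gf] := ug; have /andP[vg_ gf'] := vg'.
pose Z i := p f * (Ug u g i * p g * (Ug v g' i * p g')).
have Z0 i : (i < N)%N -> 0 <= Z i.
  move=> iN; apply: mulr_ge0; first exact: (p_ge0 xreg f).
  by apply: mulr_ge0; apply: mulr_ge0; rewrite ?(p_ge0 xreg)//; exact: (Ug_ge0 xreg N0 _ _ _ (ltnW iN)).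
have V h : (u \notin ends h) && meets g h -> valid u f (g, h).
  by move=> /andP[uh gh]; rewrite /valid /= ug_ gf uh.
have V' h : (v \notin ends h) && meets g' h -> valid v f (g', h).
  by move=> /andP[vh gh]; rewrite /valid /= vg_ gf' vh.
rewrite [leRHS](bigID (meets g')) /=.
apply: (@le_trans _ _ (
  \sum_(h | (u \notin ends h) && meets g h && meets g' h) N%:R^-1 *
    \sum_(i < N) Z i * (p h * K3 i (x h)) +
  \sum_(h | (u \notin ends h) && meets g h && ~~ meets g' h)
    \sum_(h' | (v \notin ends h') && meets g' h' && ~~ meets g h') N%:R^-1 *
    \sum_(i < N) Z i * ((p h * K2 i (x h)) * (p h' * K2 i (x h'))))); last first.
  apply: lerD; apply: ler_sum => h /andP[hV g'h].
    have /andP[uh gh] := hV.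
    have vh := valid_sym vg' uh gh ug g'h.
    rewrite (bigD1 h) /=; last by case/and4P: vh => _ _ /= -> ->.
    rewrite -[leLHS]addr0; apply: lerD; last by apply: sumr_ge0 => *; exact: expect_ge0.
    by rewrite /Z; apply: (bound_common xreg no3 N0 uv fE (V h hV) vh).
  rewrite [leRHS](bigID (meets g)) /= addrC -[leLHS]addr0.
  apply: lerD; last by apply: sumr_ge0 => *; exact: expect_ge0.
  apply: ler_sum => h' /andP[hV' gh'].
  exact: (bound_two xreg no3 no5 N0 uv fE (V h hV) (V' h' hV') gh' g'h).
rewrite -(avg_sum _ (fun i h => Z i * (p h * K3 i (x h)))).
rewrite (eq_bigr (fun h => N%:R^-1 * \sum_(i < N)
    \sum_(h' | (v \notin ends h') && meets g' h' && ~~ meets g h')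
     Z i * ((p h * K2 i (x h)) * (p h' * K2 i (x h'))))); last first.
  move=> h _; rewrite (avg_sum _ (fun i h' =>
    Z i * ((p h * K2 i (x h)) * (p h' * K2 i (x h'))))) //.
rewrite -(avg_sum _ (fun i h => \sum_(h' | (v \notin ends h') && meets g' h' && ~~ meets g h')
     Z i * ((p h * K2 i (x h)) * (p h' * K2 i (x h'))))).
rewrite -mulrDr -big_split /=; apply: avg_le => i; have iN := ltn_ord i.
rewrite [leLHS](_ : _ = Z i * ((C i * (1 - x g)) * (C i * (1 - x g')))); last first.
  by rewrite /Z; ring.
apply: le_trans (ler_wpM2l (Z0 i iN) (blockers_pair (ltnW iN) ug vg')) _.
rewrite mulrDr big_distrlr /= !mulr_sumr le_eqVlt; apply/orP; left; apply/eqP.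
by congr (_ + _); apply: eq_bigr => h _; rewrite mulr_sumr.
Qed.

End Edge.
End Assembly.

End Averaging.
Import Averaging.

(** * Assembly of the bound for one edge *)

Section OptionSums.
Variables (R : realType) (I : finType).

Lemma sum_option (Z : option I -> R) :
  \sum_A Z A = Z None + \sum_i Z (Some i).
Proof.
rewrite (bigD1 None)//=; congr (_ + _); rewrite (reindex_omap Some id) /=.
  by apply: eq_bigl => i; rewrite eqxx.
by case.
Qed.

Lemma sum_restrict (P : pred I) (Z : I -> R) : (forall i, 0 <= Z i) ->
  \sum_(i | P i) Z i <= \sum_i Z i.
Proof. by move=> Z0; rewrite [leRHS](bigID P) /= lerDl sumr_ge0. Qed.

End OptionSums.

Lemma sum_option_pair_ge (R : realType) (I : finType) (Z : option (I * I) -> R)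
    (P : pred I) (Q : I -> pred I) : (forall A, 0 <= Z A) ->
  Z None + \sum_(g | P g) \sum_(h | Q g h) Z (Some (g, h)) <= \sum_A Z A.
Proof.
move=> Z0; rewrite sum_option lerD2l.
have -> : \sum_(gh : I * I) Z (Some gh) = \sum_g \sum_h Z (Some (g, h)).
  by rewrite pair_bigA /=; apply: eq_bigr => -[g h].
apply: (@le_trans _ _ (\sum_(g | P g) \sum_h Z (Some (g, h)))).
  by apply: ler_sum => g _; apply: sum_restrict => h.
by apply: sum_restrict => g; apply: sumr_ge0.
Qed.

Section Main.
Variables (R : realType) (G : sgraph) (x : edge G -> R) (N : nat).
Hypothesis xreg : one_regular x.
Hypothesis no3 : ~ has_cycle_of_length G 3.
Hypothesis no5 : ~ has_cycle_of_length G 5.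
Hypothesis N0 : (0 < N)%N.
Variables (f : edge G) (u v : G).
Hypothesis uv : u != v.
Hypothesis fE : ends f = [set u; v].
Local Notation E := (edge G).
Local Notation q := (fun e => @a2 R (x e)).
Local Notation p e := (x e * @a2 R (x e)).
Local Notation T i := (i%:R / N%:R : R).
Local Notation Ex := (expect x q (N := N)).
Local Notation F u v A B := (Ex (fun tau al => (@evt G N f u v A B tau al)%:R)).
Local Notation at_end u g := ((u \in ends g) && (g != f)).
Local Notation V u g h := ((u \notin ends h) && meets g h).

Lemma expect_witnesses :
  \sum_A \sum_B F u v A B =
  Ex (fun tau al => (witnesses (time_order tau) al f u v)%:R).
Proof.
rewrite (eq_bigr (fun A => Ex (fun tau al => \sum_B (@evt G N f u v A B tau al)%:R)));
  last by move=> A _; rewrite expect_sum.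
rewrite -expect_sum; congr (_ / _).
apply: eq_bigr => tau _; apply: eq_bigr => a _; apply: eq_bigr => b _.
congr (_ * _); rewrite /witnesses !natrM !natr_sum -mulrA big_distrlr /= mulr_sumr.
apply: eq_bigr => A _; rewrite mulr_sumr; apply: eq_bigr => B _.
by rewrite -!natrM !mulnb.
Qed.

Lemma F_sym A B : F v u A B <= F u v B A.
Proof.
apply: (expect_le (Patterns.x01 xreg) (Patterns.q01 xreg)) => tau al.
by rewrite /Blocking.evt; case: (al f) => //=; rewrite andbC.
Qed.

(** Expanding the product of the two [S] gives one group of terms for each shape ([None] or [Some])
    of the two certificates, and each group already has its bound. *)
Lemma average_bound :
  N%:R^-1 * \sum_(i < N) p f * (Averaging.S x N f u i * Averaging.S x N f v i)
  <= Ex (fun tau al => (witnesses (time_order tau) al f u v)%:R).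
Proof.
have fE' : ends f = [set v; u] by rewrite fE setUC.
have vu : v != u by rewrite eq_sym.
pose a w i g : R := Blocking.Ug x N f w g i * (p g * (@c R * T i ^+ 2 * (1 - x g))).
pose U w i : R := Blocking.U x N f w i.
have -> : N%:R^-1 * \sum_(i < N) p f * (Averaging.S x N f u i * Averaging.S x N f v i) =
  N%:R^-1 * \sum_(i < N) p f * (U u i * U v i) +
  \sum_(g' | at_end v g') N%:R^-1 * \sum_(i < N) p f * (a v i g' * U u i) +
  \sum_(g | at_end u g) (N%:R^-1 * \sum_(i < N) p f * (a u i g * U v i) +
    \sum_(g' | at_end v g') N%:R^-1 * \sum_(i < N) p f * (a u i g * a v i g')).
  transitivity (N%:R^-1 * \sum_(i < N) (p f * (U u i * U v i) +
    \sum_(g' | at_end v g') p f * (a v i g' * U u i) +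
    \sum_(g | at_end u g) (p f * (a u i g * U v i) +
      \sum_(g' | at_end v g') p f * (a u i g * a v i g')))).
    congr (_ * _); apply: eq_bigr => i _.
    rewrite big_split /= -!mulr_sumr -!mulr_suml.
    have -> : \sum_(g | at_end u g) \sum_(g' | at_end v g') p f * (a u i g * a v i g')
        = p f * ((\sum_(g | at_end u g) a u i g) * (\sum_(g' | at_end v g') a v i g')).
      rewrite big_distrlr /= mulr_sumr; apply: eq_bigr => g _.
      by rewrite mulr_sumr.
    by rewrite /Averaging.S -/(U u i) -/(U v i); ring.
  rewrite big_split big_split /= 2!mulrDr; congr (_ + _ + _).
    by rewrite exchange_big mulr_sumr.
  rewrite exchange_big mulr_sumr; apply: eq_bigr => g _ /=.
  rewrite big_split /= mulrDr; congr (_ + _).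
  by rewrite exchange_big mulr_sumr.
have F0 A B : 0 <= F u v A B by exact: (expect_ge0 N xreg).
rewrite -expect_witnesses.
apply: le_trans (sum_option_pair_ge (Z := fun A => \sum_B F u v A B)
  (fun g => at_end u g) (fun g h => V u g h) _); last first.
  by move=> A; apply: sumr_ge0.
apply: lerD.
  apply: le_trans (sum_option_pair_ge (Z := fun B => F u v None B)
    (fun g => at_end v g) (fun g h => V v g h) _) => //.
  apply: lerD; first exact: bound_none.
  apply: ler_sum => g vg.
  apply: le_trans (sum_one_side xreg no3 N0 vu fE' vg) _.
  by apply: ler_sum => h _; exact: F_sym.
apply: ler_sum => g ug.
apply: (@le_trans _ _ (\sum_(h | V u g h) (F u v (Some (g, h)) None +
    \sum_(g' | at_end v g') \sum_(h' | V v g' h')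
      F u v (Some (g, h)) (Some (g', h'))))).
  rewrite big_split /=; apply: lerD.
    exact: (sum_one_side xreg no3 N0 uv fE ug).
  rewrite [leRHS]exchange_big /=; apply: ler_sum => g' vg'.
  exact: (sum_two_sides xreg no3 no5 N0 uv fE ug vg').
apply: ler_sum => h _.
exact: (sum_option_pair_ge (Z := fun B => F u v (Some (g, h)) B)
    (fun g => at_end v g) (fun g h => V v g h)).
Qed.

Lemma gamma_le_average :
  gamma R * x f <= N%:R^-1 * \sum_(i < N) p f * (Averaging.S x N f u i * Averaging.S x N f v i).
Proof.
have xf := Patterns.x01 xreg f; have /andP[xf0 xf1] := xf.
pose eta w : R := \sum_(g | at_end w g) x g ^+ 2.
have eta0 w : 0 <= eta w by apply: sumr_ge0 => *; exact: sqr_ge0.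
have sumE w : w \in ends f -> \sum_(g | at_end w g) x g = 1 - x f.
  by move=> wf; exact: sum_at.
have eta1 w : w \in ends f -> eta w <= 1.
  move=> wf; apply: (@le_trans _ _ (1 - x f)); last by lra.
  rewrite -(sumE w wf); apply: ler_sum => g _.
  by have /andP[g0 g1] := Patterns.x01 xreg g; rewrite expr2 ler_piMr.
have SB w i : w \in ends f -> (i < N)%N ->
    0 <= @B R (1 - x f) (eta w) (T i) <= Averaging.S x N f w i.
  move=> wf iN; have t01 := Patterns.T01 R N0 (ltnW iN).
  rewrite B_ge0 ?eta0 ?eta1//= -(sumE w wf).
  exact: side_bound (Patterns.x01 xreg) t01.
have := riemann_bound xf (eta0 u) (eta0 v) N0.
move=> /(ler_wpM2l xf0); rewrite [x f * gamma R]mulrC => /le_trans; apply.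
rewrite mulrA mulrCA ler_wpM2l ?invr_ge0// mulr_sumr; apply: ler_sum => i _.
have /andP[b0 bS] := SB u i (uf fE) (ltn_ord i).
have /andP[b0' bS'] := SB v i (vf fE) (ltn_ord i).
by apply: ler_wpM2l; [exact: p_ge0|exact: ler_pM].
Qed.

End Main.

(* Second conjunct: gamma is 0.478983 correct to six decimals
   (478/10^3 + 983/10^6 = 0.478983; gamma = 0.47898256...). *)
Theorem theorem4 (R : realType) :
  (forall (G : sgraph) (x : edge G -> R),
     one_regular x ->
     ~ has_cycle_of_length G 3 ->
     ~ has_cycle_of_length G 5 ->
     forall f : edge G, gamma R * x f <= selection_prob x (@a2 R) f)
  /\ `| gamma R - (478 / 10 ^+ 3 + 983 / 10 ^+ 6) | <= 1 / (2 * 10 ^+ 6).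
Proof.
split; last exact: gamma_approx.
move=> G x xreg no3 no5 f.
have [u uf_] : exists u, u \in ends f.
  by apply/card_gt0P; rewrite (edges_card2 (svalP f)).
have [v uv fE] := other_end uf_.
have [K KE] := selection_ge_expect (Patterns.x01 xreg) (Patterns.q01 xreg) fE.
apply/ler_addgt0Pr => d d0.
(* A grid with more than [|K| / d] points makes the error [K / N] at most [d]. *)
have b := archi_boundP (divr_ge0 (normr_ge0 K) (ltW d0)).
set N := Num.bound _ in b.
have N0 : (0 < N)%N.
  by rewrite -(ltr0n R); apply: le_lt_trans b; exact: divr_ge0 (normr_ge0 K) (ltW d0).
apply: le_trans (gamma_le_average xreg N0 fE) _.
apply: le_trans (average_bound xreg no3 no5 N0 uv fE) _.
apply: le_trans (KE N N0) _; rewrite lerD2l ler_pdivrMr ?ltr0n// mulrC.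
by apply: le_trans (ler_norm K) _; rewrite -ler_pdivrMr// ltW.
Qed.
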